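(* Let $\epsilon>0$. There exists $P=P(\epsilon)$ such that for every prime $p\ge P$, every positive integer $d$, every integer $s>(2+\epsilon)d^2$ and all $a_1,\dots,a_s,b_1,\dots,b_s\in\mathbb{Q}_p$, the system \[ a_1x_1^d+\cdots+a_sx_s^d=0,\qquad b_1x_1^d+\cdots+b_sx_s^d=0 \] has a solution $(x_1,\dots,x_s)\in\mathbb{Q}_p^s\setminus\{\mathbf 0\}$. *)

(* Defs.v *)
From HB Require Import structures.
From mathcomp Require Import all_boot all_order all_algebra.
From mathcomp Require Import boolp reals.

Set Implicit Arguments.
Unset Strict Implicit.
Unset Printing Implicit Defensive.

Import Order.TTheory GRing.Theory Num.Theory.
Local Open Scope ring_scope.

(* Z_p as the inverse limit of the rings Z / p^n Z. The n-th component is the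
   residue mod p^n, represented by its canonical representative in [0, p^n), so
   that Leibniz equality is equality of p-adic integers; the single equation
   below says both that the representative is reduced and that the components
   are compatible. The primality proof is a parameter of the type because the
   ring structures declared on it depend on it. *)
Record padic_int (p : nat) (p_pr : prime p) := PadicInt {
  residue :> nat -> int;
  residueE : forall n, residue n = (residue n.+1 %% (p ^ n)%N)%Z }.

Section PadicIntRing.
Variables (p : nat) (p_pr : prime p).
Local Notation Zp := (padic_int p_pr).
Implicit Types x y z : Zp.

HB.instance Definition _ := gen_eqMixin Zp.
HB.instance Definition _ := gen_choiceMixin Zp.

Lemma padic_intP x y : (forall n, x n = y n) -> x = y.
Proof.
case: x y => [u hu] [v hv] /= /funext uv.
by case: _ / uv hv => hv; congr PadicInt; exact: Prop_irrelevance.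
Qed.

Lemma residue_mod x n : (x n %% (p ^ n)%N)%Z = x n.
Proof. by rewrite residueE modz_mod. Qed.

Lemma modz_exp_leq (z : int) m n : (m <= n)%N ->
  ((z %% (p ^ n)%N)%Z %% (p ^ m)%N)%Z = (z %% (p ^ m)%N)%Z.
Proof.
move=> /subnK <-; rewrite [in RHS](divz_eq z (p ^ (n - m + m))%N) expnD PoszM.
by rewrite mulrA modzMDl.
Qed.

Lemma residue_leq x m n : (m <= n)%N -> (x n %% (p ^ m)%N)%Z = x m.
Proof.
move=> /subnK <-; elim: (n - m)%N => [|k IHk]; first by rewrite residue_mod.
by rewrite -IHk addSn (residueE x (k + m)) modz_exp_leq ?leq_addl.
Qed.

Lemma padic_of_subproof (u : nat -> int) :
    (forall n, (u n.+1 = u n %[mod (p ^ n)%N])%Z) ->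
  forall n, (u n %% (p ^ n)%N)%Z
            = ((u n.+1 %% (p ^ n.+1)%N)%Z %% (p ^ n)%N)%Z.
Proof.
by move=> hu n; rewrite modz_exp_leq.
Qed.

Definition padic_of (u : nat -> int)
    (hu : forall n, (u n.+1 = u n %[mod (p ^ n)%N])%Z) : Zp :=
  PadicInt p_pr (padic_of_subproof hu).

Lemma padic_const_subproof (c : int) (n : nat) : (c = c %[mod (p ^ n)%N])%Z.
Proof. by []. Qed.

Lemma padic_add_subproof x y n :
  (x n.+1 + y n.+1 = x n + y n %[mod (p ^ n)%N])%Z.
Proof. by rewrite -[LHS]modzDm -!residueE. Qed.

Lemma padic_opp_subproof x n : (- x n.+1 = - x n %[mod (p ^ n)%N])%Z.
Proof. by rewrite -[LHS]modzNm -!residueE. Qed.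

Lemma padic_mul_subproof x y n :
  (x n.+1 * y n.+1 = x n * y n %[mod (p ^ n)%N])%Z.
Proof. by rewrite -[LHS]modzMm -!residueE. Qed.

Definition padic_const (c : int) := padic_of (padic_const_subproof c).
Definition padic_add x y := padic_of (padic_add_subproof x y).
Definition padic_opp x := padic_of (padic_opp_subproof x).
Definition padic_mul x y := padic_of (padic_mul_subproof x y).

Lemma padic_addA : associative padic_add.
Proof. by move=> x y z; apply: padic_intP => n /=; rewrite modzDml modzDmr addrA. Qed.

Lemma padic_addC : commutative padic_add.
Proof. by move=> x y; apply: padic_intP => n /=; rewrite addrC. Qed.

Lemma padic_add0 : left_id (padic_const 0) padic_add.
Proof. by move=> x; apply: padic_intP => n /=; rewrite mod0z add0r residue_mod. Qed.

Lemma padic_addN : left_inverse (padic_const 0) padic_opp padic_add.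
Proof. by move=> x; apply: padic_intP => n /=; rewrite modzDml addNr. Qed.

HB.instance Definition _ :=
  GRing.isZmodule.Build Zp padic_addA padic_addC padic_add0 padic_addN.

Lemma padic_mulA : associative padic_mul.
Proof. by move=> x y z; apply: padic_intP => n /=; rewrite modzMml modzMmr mulrA. Qed.

Lemma padic_mulC : commutative padic_mul.
Proof. by move=> x y; apply: padic_intP => n /=; rewrite mulrC. Qed.

Lemma padic_mul1 : left_id (padic_const 1) padic_mul.
Proof. by move=> x; apply: padic_intP => n /=; rewrite modzMml mul1r residue_mod. Qed.

Lemma padic_mulD : left_distributive padic_mul padic_add.
Proof.
by move=> x y z; apply: padic_intP => n /=; rewrite modzMml modzDm mulrDl.
Qed.

Lemma padic_1neq0 : padic_const 1 != padic_const 0.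
Proof.
apply/eqP => /(congr1 (fun x : Zp => x 1%N)) /=; rewrite expn1 mod0z modz_small //.
by rewrite /= ltz_nat prime_gt1.
Qed.

HB.instance Definition _ := GRing.Zmodule_isComNzRing.Build Zp
  padic_mulA padic_mulC padic_mul1 padic_mulD padic_1neq0.

Lemma residue0 n : (0 : Zp) n = 0.
Proof. exact: mod0z. Qed.

Lemma residue1 n : (1 : Zp) n = (1 %% (p ^ n)%N)%Z.
Proof. by []. Qed.

Lemma residueD x y n : (x + y) n = ((x n + y n) %% (p ^ n)%N)%Z.
Proof. by []. Qed.

Lemma residueN x n : (- x) n = ((- x n) %% (p ^ n)%N)%Z.
Proof. by []. Qed.

Lemma residueM x y n : (x * y) n = ((x n * y n) %% (p ^ n)%N)%Z.
Proof. by []. Qed.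

Definition padic_unit : pred Zp := fun x => `[< exists y, y * x = 1 >].

Definition padic_inv x : Zp :=
  if pselect (exists y, y * x = 1) is left e then projT1 (cid e) else x.

Lemma padic_mulV : {in padic_unit, left_inverse 1 padic_inv *%R}.
Proof.
move=> x /asboolP ex; rewrite /padic_inv.
by case: pselect => // e; case: (cid e).
Qed.

Lemma padic_unitP x y : y * x = 1 -> padic_unit x.
Proof. by move=> yx; apply/asboolP; exists y. Qed.

Lemma padic_inv_out : {in [predC padic_unit], padic_inv =1 id}.
Proof.
move=> x /negP nux; rewrite /padic_inv.
by case: pselect => // e; case: nux; apply/asboolP.
Qed.

HB.instance Definition _ := GRing.ComNzRing_hasMulInverse.Build Zp
  padic_mulV padic_unitP padic_inv_out.

Lemma padic_neq0 x : x != 0 -> exists n, x n != 0.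
Proof.
move=> /eqP x0; apply: contrapT => h; apply: x0; apply: padic_intP => n.
by rewrite residue0; apply/eqP/negPn/negP => xn; apply: h; exists n.
Qed.

Lemma padic_int_integral x y : x * y = 0 -> (x == 0) || (y == 0).
Proof.
move=> xy0; apply/negPn/negP; rewrite negb_or.
move=> /andP[/padic_neq0[k xk] /padic_neq0[l yl]].
have ndvd (z : Zp) (m n : nat) : (m <= n)%N -> z m != 0 ->
    ((0 < `|z n|) && (logn p `|z n| < m))%N.
  move=> mn; rewrite -(residue_leq z mn) => /eqP zm.
  have zn0 : (0 < `|z n|)%N.
    by rewrite absz_gt0; apply/eqP => zn; apply: zm; rewrite zn mod0z.
  rewrite zn0 ltnNge -pfactor_dvdn //; apply/negP => dv.
  by apply: zm; apply/dvdz_mod0P.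
have /andP[x0 xlt] := ndvd x k (k + l)%N (leq_addr _ _) xk.
have /andP[y0 ylt] := ndvd y l (k + l)%N (leq_addl _ _) yl.
have /dvdz_mod0P : ((x (k + l)%N * y (k + l)%N) %% (p ^ (k + l))%N)%Z = 0.
  by rewrite -residueM xy0 residue0.
rewrite dvdzE abszM pfactor_dvdn ?muln_gt0 ?x0 // lognM //.
by rewrite leqNgt -addSn leq_add // ltnW.
Qed.

HB.instance Definition _ :=
  GRing.ComUnitRing_isIntegral.Build Zp padic_int_integral.

End PadicIntRing.

Definition padic (p : nat) (p_pr : prime p) : fieldType :=
  {fraction (padic_int p_pr)}.

(* Main.v *)
(* Moving the variables by p^c and the pair of forms by GL_2(Q_p), choose a
   lattice minimising an integer-valued potential (a version of the
   Davenport-Lewis normalisation). At the minimum at least s/d of the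
   coefficient vectors are primitive at level 0, and at least s/(2d) of these lie
   outside any given line modulo p. The potential is bounded below as soon as no
   line of Q_p^2 contains more than half of the vectors; if one does, a single
   form in more than s/2 variables remains, and it is solved by applying the
   first case to two disjoint copies of it.

   Write d = p^t m with p not dividing m and q = p^(t+1). The values of x^d are 0
   and at least (p-1)/m residues that are distinct modulo p. By Hensel it is
   enough to find a zero of the system modulo q in which two variables with
   independent coefficient vectors are units. In the group ring
   F_p[(Z/q)^2] = F_p[X,Y]/(X^q,Y^q), a vector (a,b) admits, for every e up to the
   number of its nonzero weights, a combination of the elements g^(x^d) whose
   lowest form is (aX+bY)^e. If a product of 2(q-1) such linear forms has a
   nonzero coefficient at X^(q-1)Y^(q-1), the product of the combinations spans
   the socle, so every element of (Z/q)^2 is represented.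

   Such a product of linear forms exists once there are 2(q-1) + 4p^t of them and
   at least q-1 lie off each line. Since the socle of F_p[X,Y]/(X^q,Y^q) lives in
   a single degree, it suffices to treat a product in which each line has lost
   4p^t factors; rounding its exponents up to multiples of p^t and taking p^t-th
   roots reduces to q = p. There, W = u X^p + v Y^p with few distinct linear
   factors is impossible, by comparing the degree of the Wronskian uv' - u'v with
   that of the repeated part of W. The slack 4p^t is what epsilon pays for. *)

Require Import Defs.
From mathcomp Require Import all_boot all_order all_algebra.
From mathcomp Require Import finfield boolp reals.
From mathcomp Require Import ring lra zify.

Set Implicit Arguments.
Unset Strict Implicit.
Unset Printing Implicit Defensive.

Import Order.TTheory GRing.Theory Num.Theory.
Local Open Scope ring_scope.

(** * Products of linear forms modulo (X^q, Y^q) *)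

Lemma coefM_top (R : nzRingType) (u v : {poly R}) (a b : nat) :
  (size u <= a.+1)%N -> (size v <= b.+1)%N -> (u * v)`_(a + b) = u`_a * v`_b.
Proof.
move=> su sv; have aab : (a < (a + b).+1)%N by lia.
rewrite coefM (bigD1 (Ordinal aab)) //= addKn big1 ?addr0 // => i.
rewrite -val_eqE /= => ia; have := ltn_ord i => ilt.
have [ai|ai] := ltnP a i; first by rewrite nth_default ?mul0r // (leq_trans su).
by rewrite [v`_ _]nth_default ?mulr0 // (leq_trans sv) //; lia.
Qed.

Section DegreeForms.
Variable F : fieldType.
Implicit Types (w : {poly F}) (l : option F).

(* [Some t] is the line of the form [X - t Y], [None] that of [Y]; a coefficient
   vector [(a, b)] is read as [a X + b Y]. Forms are dehomogenised at [Y = 1]. *)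
Definition line_form l : {poly F} := if l is Some t then 'X - t%:P else 1.

(* The form of degree [D] with dehomogenisation [w] is in the ideal [(X^q, Y^q)]. *)
Definition mem_powers (q D : nat) w :=
  forall j, (j < q)%N -> (D < q + j)%N -> w`_j = 0.

Lemma line_form_neq0 l : line_form l != 0.
Proof. by case: l => [t|] /=; rewrite ?polyXsubC_eq0 ?oner_eq0. Qed.

Lemma size_line_form l : (size (line_form l) <= 2)%N.
Proof. by case: l => [t|] /=; rewrite ?size_XsubC ?size_poly1. Qed.

Lemma mem_powersM q D1 D2 w1 w2 : (size w2 <= D2.+1)%N ->
  mem_powers q D1 w1 -> mem_powers q (D1 + D2) (w1 * w2).
Proof.
move=> s2 m1 j jq Dj; rewrite coefM big1 // => a _.
have [h|h] := leqP (size w2) (j - a); first by rewrite [w2`_ _]nth_default ?mulr0.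
by rewrite m1 ?mul0r //; have := ltn_ord a; lia.
Qed.

(* The only socle of F[X, Y] / (X^q, Y^q) is in degree 2q - 2. *)
Lemma mem_powers_socle q D w l1 l2 : (D.+2 < q + q)%N -> l1 != l2 ->
  mem_powers q D.+1 (w * line_form l1) -> mem_powers q D.+1 (w * line_form l2) ->
  mem_powers q D w.
Proof.
move=> Dq l12 m1 m2.
have [mw mwX] : mem_powers q D.+1 w /\ mem_powers q D.+1 (w * 'X).
  have mX t : mem_powers q D.+1 w -> mem_powers q D.+1 (w * ('X - t%:P)) ->
      mem_powers q D.+1 (w * 'X).
    move=> mw mwt j jq Dj; have := mwt j jq Dj.
    by rewrite mulrBr coefB coefMC mw // mul0r subr0.
  suff mw : mem_powers q D.+1 w.
    split=> //; case: l1 l2 l12 m1 m2 => [t|] [t'|] //= _ m1 m2;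
      by [exact: (mX t) | exact: (mX t')].
  case: l1 l2 l12 m1 m2 => [t|] [t'|] //=; rewrite ?mulr1 // => tt' m1 m2 j jq Dj.
  have tt0 : t' - t != 0 by rewrite subr_eq0; apply: contraNneq tt' => ->.
  apply: (mulIf tt0); rewrite mul0r -coefMC polyCB.
  have -> : w * (t'%:P - t%:P) = w * ('X - t%:P) - w * ('X - t'%:P) by ring.
  by rewrite coefB m1 // m2 // subrr.
move=> j jq Dj; have [Dj1|Dj1] := ltnP D.+1 (q + j); first exact: mw.
by have := mwX j.+1; rewrite coefMX /=; apply; lia.
Qed.

End DegreeForms.

Section PrimeField.
Variables (p : nat) (p_pr : prime p).
Local Notation F := 'F_p.

Lemma natr_Fp_inj a b : (a < p)%N -> (b < p)%N -> a%:R = b%:R :> F -> a = b.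
Proof.
move=> ap bp /(congr1 (@nat_of_ord _)); rewrite !val_Fp_nat //.
by rewrite !modn_small.
Qed.

Lemma exprFp (t : F) : t ^+ p = t.
Proof. by rewrite -[RHS]expf_card card_Fp. Qed.

Lemma expr_FpX (t : F) n : t ^+ (p ^ n) = t.
Proof. by elim: n => [|n IH]; rewrite ?expr1 // expnS mulnC exprM IH exprFp. Qed.

Lemma pchar_poly_Fp : p \in [pchar {poly F}].
Proof. by rewrite pchar_poly (pchar_Fp p_pr). Qed.

Lemma expr_poly_Fp (w : {poly F}) n : w ^+ (p ^ n) = w \Po 'X^(p ^ n).
Proof.
elim/poly_ind: w => [|w c IH].
  by rewrite comp_poly0 expr0n expn_eq0 -leqn0 leqNgt prime_gt0.
rewrite exprDn_pchar; last by rewrite pnatX pnatE // pchar_poly_Fp.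
rewrite exprMn IH comp_polyD comp_polyM comp_polyX comp_polyC; congr (_ + _).
by rewrite -polyC_exp expr_FpX.
Qed.

Lemma wronskian_neq0 (u v : {poly F}) : u != 0 -> v != 0 ->
  (size u <= p)%N -> (size v <= p)%N -> size u != size v ->
  u * v^`() != u^`() * v.
Proof.
move=> u0 v0 su sv suv.
have su0 : (0 < size u)%N by rewrite size_poly_gt0.
have sv0 : (0 < size v)%N by rewrite size_poly_gt0.
pose a := (size u).-1; pose b := (size v).-1.
have XE (y : {poly F}) j : ('X * y^`())`_j = y`_j *+ j.
  by rewrite coefXM coef_deriv; case: j.
have sX (y : {poly F}) k : (size y <= k.+1)%N -> (size ('X * y^`())%R <= k.+1)%N.
  by move=> sy; apply/leq_sizeP => j kj; rewrite XE nth_default ?mul0rn // (leq_trans sy).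
apply/eqP => /(congr1 (fun y : {poly F} => ('X * y)`_(a + b))).
have -> : 'X * (u * v^`()) = u * ('X * v^`()) by ring.
have su1 : (size u <= a.+1)%N by rewrite /a prednK.
have sv1 : (size v <= b.+1)%N by rewrite /b prednK.
rewrite ['X * (u^`() * v)]mulrA (coefM_top su1 (sX _ _ sv1)) (coefM_top (sX _ _ su1) sv1) !XE.
rewrite -[_ *+ b]mulr_natr -[_ *+ a]mulr_natr mulrA [u`_a * _ * v`_b]mulrAC => /eqP; rewrite -subr_eq0 -mulrBr.
rewrite !mulf_eq0 -!lead_coefE !lead_coef_eq0 (negPf u0) (negPf v0) /=.
rewrite subr_eq0 => /eqP ba.
have ab : b = a by apply: natr_Fp_inj ba; rewrite /a /b; lia.
by move: suv; rewrite -(prednK su0) -(prednK sv0) -/a -/b ab eqxx.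
Qed.

Lemma wronskian_eq0 (u v : {poly F}) : u != 0 -> v != 0 ->
  (size u <= p)%N -> (size v <= p)%N -> u * v^`() = u^`() * v ->
  exists2 k : F, k != 0 & u = k *: v.
Proof.
move=> u0 v0 su sv uv.
have suv : size u = size v.
  by apply/eqP/negPn/negP => suv; have /eqP := wronskian_neq0 u0 v0 su sv suv.
pose k := lead_coef u / lead_coef v.
have k0 : k != 0 by rewrite mulf_neq0 ?invr_eq0 ?lead_coef_eq0.
exists k => //; apply/eqP; rewrite -subr_eq0; apply/negPn/negP => y0.
have sy : (size (u - k *: v)%R < size v)%N.
  rewrite -(prednK (n := size v)) ?size_poly_gt0 // ltnS; apply/leq_sizeP => j.
  rewrite leq_eqVlt => /orP[/eqP <-|sj]; rewrite coefB coefZ.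
    have -> : u`_(size v).-1 = lead_coef u by rewrite lead_coefE suv.
    by rewrite -lead_coefE mulfVK ?subrr // lead_coef_eq0.
  by rewrite !nth_default ?mulr0 ?subrr ?suv // -(prednK (n := size v)) ?size_poly_gt0.
have /eqP := wronskian_neq0 y0 v0 (leq_trans (ltnW sy) sv) sv (negbT (ltn_eqF sy)).
by apply; rewrite derivB derivZ !mulrBl uv -!mul_polyC; ring.
Qed.

End PrimeField.

Lemma big_option (T : finType) (R : Type) (idx : R) (op : Monoid.com_law idx)
  (f : option T -> R) :
  \big[op/idx]_l f l = op (f None) (\big[op/idx]_t f (Some t)).
Proof.
rewrite (bigD1 None) //=; congr (op _ _).
rewrite (reindex_omap (@Some T) id) /=; last by case.
by apply: eq_bigl => t; rewrite eqxx.
Qed.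

Lemma size_wronskian (R : nzRingType) (u v : {poly R}) : u != 0 -> v != 0 ->
  (size (u * v^`() - u^`() * v)%R <= (size u + size v).-2)%N.
Proof.
move=> u0 v0; rewrite (leq_trans (size_polyD _ _)) // size_polyN geq_max.
have := lt_size_deriv u0; have := lt_size_deriv v0.
move: (size_polyMleq u v^`()) (size_polyMleq u^`() v).
move: (size (u * _)) (size (_ * v)) => a b.
move: (size u) (size v) (size u^`()) (size v^`()); lia.
Qed.

Section LinePowers.
Variables (p : nat) (p_pr : prime p).
Local Notation F := 'F_p.
Implicit Types (z : F -> nat).

Lemma XsubC_exp_ndvdp z t : (z t < p)%N ->
  ~~ (('X - t%:P) ^+ p %| \prod_(u : F) ('X - u%:P) ^+ z u).
Proof.
move=> zt; rewrite (bigD1 t) //=.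
have -> : ('X - t%:P) ^+ p =
    ('X - t%:P) ^+ z t * (('X - t%:P) * ('X - t%:P) ^+ (p - z t).-1) :> {poly F}.
  by rewrite -exprS -exprD; congr (_ ^+ _); lia.
rewrite dvdp_mul2l; last by rewrite expf_neq0 // polyXsubC_eq0.
apply/negP => /(dvdp_trans (dvdp_mulr _ (dvdpp _))).
rewrite dvdp_XsubCl /root horner_prod; apply/negP/prodf_neq0 => u ut.
by rewrite horner_exp hornerXsubC expf_neq0 // subr_eq0 eq_sym.
Qed.

Lemma dvdp_deriv_prod z :
  let V := \prod_(u : F) ('X - u%:P) ^+ (z u).-1 in
  let W := \prod_(u : F) ('X - u%:P) ^+ z u in (V %| W) && (V %| W^`()).
Proof.
apply: (big_rec2 (fun V W : {poly F} => is_true ((V %| W) && (V %| W^`())))).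
  by rewrite !dvd1p.
move=> u V W _ /andP[VW VW']; apply/andP; split.
  by rewrite dvdp_mul // dvdp_exp2l // leq_pred.
rewrite derivM dvdp_add // ?dvdp_mul // ?dvdp_exp2l ?leq_pred //.
by rewrite deriv_exp derivXsubC mul1r -mulr_natl dvdp_mull.
Qed.

Lemma size_prod_XsubC_exp z :
  size (\prod_(u : F) ('X - u%:P) ^+ z u) = (\sum_u z u).+1.
Proof.
rewrite size_prod => [|u _]; last by rewrite expf_neq0 // polyXsubC_eq0.
under eq_bigr do rewrite size_exp_XsubC -addn1.
by rewrite big_split /= sum1_card -addSn addnK.
Qed.

Lemma mem_powers_prime (z0 : nat) z : (z0 < p)%N -> (forall u, (z u < p)%N) ->
  (0 < #|[set u | (0 < z u)%N]| + (0 < z0))%N ->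
  ((z0 + \sum_u z u) + (#|[set u | (0 < z u)%N]| + (0 < z0)) <= p + p)%N ->
  ~ mem_powers p (z0 + \sum_u z u) (\prod_(u : F) ('X - u%:P) ^+ z u).
Proof.
set m := #|_|; set S := (\sum_u z u)%N; set W := \prod_u _; set D := (z0 + S)%N.
move=> z0p zp m0 Dm mW.
have sW : size W = S.+1 := size_prod_XsubC_exp z.
have W0 : W != 0 by rewrite -size_poly_gt0 sW.
have [Dp|pD] := ltnP D p.
  have : W`_S == 0 by rewrite mW //; lia.
  by rewrite -[S]/(S.+1.-1) -sW -lead_coefE lead_coef_eq0 (negPf W0).
pose n := (D - p)%N; pose u := drop_poly p W; pose v := take_poly p W.
have WE : W = v + u * 'X^p by rewrite poly_take_drop.
have su : size u = (S.+1 - p)%N by rewrite size_drop_poly sW.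
have sv : (size v <= n.+1)%N.
  apply/leq_sizeP => j nj; rewrite coef_take_poly; case: ltnP => // jp.
  by apply: mW => //; lia.
have u0 : u != 0.
  by apply/eqP => u0; move: sv; rewrite -[v]addr0 -(mul0r 'X^p) -u0 -WE sW; lia.
have v0 : v != 0.
  apply/eqP => v0; have /negP := XsubC_exp_ndvdp (zp 0); apply.
  by rewrite -/W WE v0 add0r subr0 dvdp_mull.
have W'E : W^`() = v^`() + u^`() * 'X^p.
  rewrite WE derivD derivM derivXn -mulr_natr.
  by rewrite (pcharf0 (pchar_poly_Fp p_pr)) !mulr0 addr0.
have [uv|uv] := eqVneq (u * v^`()) (u^`() * v).
  have [||k k0 uE] := wronskian_eq0 p_pr u0 v0 _ _ uv; first by rewrite su; lia.
    by apply: leq_trans sv _; lia.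
  have /negP := XsubC_exp_ndvdp (zp (- k^-1)); apply; rewrite -/W WE.
  have := expr_poly_Fp p_pr ('X - (- k^-1)%:P) 1; rewrite expn1 => ->.
  rewrite comp_polyB comp_polyX comp_polyC uE.
  have -> : v + k *: v * 'X^p = (k *: v) * ('X^p - (- k^-1)%:P).
    rewrite polyCN opprK mulrDr addrC; congr (_ + _).
    by rewrite mulrC mul_polyC scalerA mulVf // scale1r.
  by rewrite dvdp_mull.
have /andP[VW VW'] := dvdp_deriv_prod z.
have Wr : u * W^`() - u^`() * W = u * v^`() - u^`() * v by rewrite W'E WE; ring.
have : u * v^`() - u^`() * v != 0 by rewrite subr_eq0.
move=> /(@dvdp_leq _ (\prod_(u : F) ('X - u%:P) ^+ (z u).-1)).
rewrite -Wr dvdp_add ?dvdpNr ?dvdp_mull // Wr size_prod_XsubC_exp => /(_ isT).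
have Sm : (\sum_u (z u).-1 + m)%N = S.
  have -> : m = (\sum_u (0 < z u))%N.
    by rewrite /m -sum1_card big_mkcond; apply: eq_bigr => t _; rewrite inE; case: ltnP.
  by rewrite -big_split; apply: eq_bigr => t _ /=; lia.
move=> sV; have := leq_trans sV (size_wronskian u0 v0).
move: u0 sv; rewrite -size_poly_gt0 su; move: (size v) => b u0 sv.
by move: (\sum_u (z u).-1)%N Sm => V; clear -Dm u0 sv pD; lia.
Qed.

End LinePowers.

Lemma size_prod_le (R : nzRingType) (I : Type) (r : seq I) (P : pred I)
    (f : I -> {poly R}) (k : I -> nat) :
  (forall i, P i -> (size (f i) <= (k i).+1)%N) ->
  (size (\prod_(i <- r | P i) f i)%R <= (\sum_(i <- r | P i) k i).+1)%N.
Proof.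
move=> fk.
apply: (big_ind2 (fun (w : {poly R}) (n : nat) => is_true (size w <= n.+1)%N)) => //.
  by rewrite size_poly1.
move=> w1 n1 w2 n2 h1 h2; apply: leq_trans (size_polyMleq _ _) _.
by move: (size w1) (size w2) h1 h2 => a b; lia.
Qed.

Lemma not_mem_powers_low (F : fieldType) q D (w : {poly F}) :
  w != 0 -> (size w <= D.+1)%N -> (D < q)%N -> ~ mem_powers q D w.
Proof.
move=> w0 sw Dq mw; have s0 : (0 < size w)%N by rewrite size_poly_gt0.
have : w`_(size w).-1 == 0.
  by apply/eqP/mw; move: (size w) sw s0 => a; lia.
by rewrite -lead_coefE lead_coef_eq0 (negPf w0).
Qed.

Section LinePowers.
Variables (p : nat) (p_pr : prime p).
Local Notation F := 'F_p.
Local Notation L := (option F).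
Implicit Types (z e : L -> nat).

Lemma prod_lines_neq0 e : \prod_l line_form l ^+ e l != 0 :> {poly F}.
Proof. by apply/prodf_neq0 => l _; rewrite expf_neq0 // line_form_neq0. Qed.

Lemma size_prod_line_exp e :
  (size (\prod_l line_form l ^+ e l : {poly F})%R <= (\sum_l e l).+1)%N.
Proof.
apply: size_prod_le.
move=> l _; apply: leq_trans (size_poly_exp_leq _ _) _.
rewrite ltnS -[leqRHS]mul1n leq_mul2r.
by case: l => [t|] /=; rewrite ?size_XsubC ?size_poly1 orbT.
Qed.

Lemma mem_powers_prime_lines z : (forall l, (z l < p)%N) ->
  (0 < #|[set l | (0 < z l)%N]|)%N ->
  (\sum_l z l + #|[set l | (0 < z l)%N]| <= p + p)%N ->
  ~ mem_powers p (\sum_l z l) (\prod_l line_form l ^+ z l).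
Proof.
move=> zp.
have -> : #|[set l | (0 < z l)%N]|
          = (#|[set t : F | (0 < z (Some t))%N]| + (0 < z None))%N.
  by rewrite -!sum1dep_card big_mkcond big_option -big_mkcond addnC /=; case: ifP.
rewrite !big_option /= expr1n mul1r => m0 Dm.
by apply: (mem_powers_prime p_pr).
Qed.

Lemma mem_powers_expr n D (w : {poly F}) :
  mem_powers (p ^ n.+1) (p ^ n * D) (w ^+ (p ^ n)) -> mem_powers p D w.
Proof.
have P0 : (0 < p ^ n)%N by rewrite expn_gt0 prime_gt0.
rewrite expr_poly_Fp // => mw j jp Dj.
have := mw (p ^ n * j)%N; rewrite coef_comp_poly_Xn // dvdn_mulr // mulKn //.
by apply; rewrite expnSr ?ltn_mul2l -?mulnDr ?ltn_mul2l P0.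
Qed.

Lemma mem_powers_lines n e (m := #|[set l | (0 < e l)%N]|) :
  (forall l, (0 < e l)%N -> (e l + 4 * p ^ n < p ^ n.+1)%N) ->
  (\sum_l e l + m * (4 * p ^ n) < 2 * p ^ n.+1 + 4 * p ^ n)%N ->
  ~ mem_powers (p ^ n.+1) (\sum_l e l) (\prod_l line_form l ^+ e l).
Proof.
have P0 : (0 < p ^ n)%N by rewrite expn_gt0 prime_gt0.
have := @mem_powers_expr n; rewrite expnSr.
move: (p ^ n)%N P0 => P P0 descent e_lt e_sum.
have mE : m = (\sum_l (0 < e l))%N.
  by rewrite /m -sum1dep_card big_mkcond; apply: eq_bigr => l _; case: ltnP.
have [m_le1|m_ge2] := leqP m 1.
  apply: not_mem_powers_low (prod_lines_neq0 e) (size_prod_line_exp e) _.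
  have : (\sum_l e l <= m * (P * p).-1)%N.
    rewrite mE big_distrl; apply: leq_sum => l _ /=.
    by have := e_lt l; case: ltnP; lia.
  by have := prime_gt1 p_pr; nia.
pose z l := ((e l + P.-1) %/ P)%N.
have zP l : (e l <= P * z l < e l + P)%N.
  have := divn_eq (e l + P.-1) P; have := ltn_pmod (e l + P.-1) P0.
  by rewrite -/(z l); lia.
have z0 l : (0 < z l)%N = (0 < e l)%N.
  by have := zP l; case: (ltnP 0 (e l)); case: (ltnP 0 (z l)); nia.
have sz : (P * \sum_l z l + m <= \sum_l e l + m * P)%N.
  rewrite mE big_distrr big_distrl /= -!big_split; apply: leq_sum => l _ /=.
  by have := zP l; have := z0 l; case: (ltnP 0 (e l)) => ?; [lia|]; case: (ltnP 0 (z l)); nia.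
have mz : #|[set l | (0 < z l)%N]| = m.
  by apply: eq_card => l; rewrite !inE z0.
move=> me; apply: (@mem_powers_prime_lines z).
- move=> l; have := zP l; have := z0 l; have := e_lt l.
  by have := prime_gt1 p_pr; case: (ltnP 0 (e l)) => ?; case: (ltnP 0 (z l)); nia.
- by rewrite mz; lia.
- by rewrite mz; nia.
apply: descent.
have -> : (P * \sum_l z l = \sum_l e l + \sum_l (P * z l - e l))%N.
  rewrite big_distrr -big_split; apply: eq_bigr => l _ /=.
  by have := zP l; lia.
have -> : (\prod_l line_form l ^+ z l) ^+ P =
    \prod_l line_form l ^+ e l * \prod_l line_form l ^+ (P * z l - e l) :> {poly F}.
  rewrite -prodrXl -big_split; apply: eq_bigr => l _ /=.
  by rewrite -exprM -exprD; congr (_ ^+ _); have := zP l; lia.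
exact: mem_powersM (size_prod_line_exp _) me.
Qed.
End LinePowers.

Lemma subset_of_card (T : finType) (A : {set T}) n :
  (n <= #|A|)%N -> exists2 B : {set T}, B \subset A & #|B| = n.
Proof.
move=> nA; exists [set x in take n (enum A)].
  by apply/subsetP => x; rewrite inE => /mem_take; rewrite mem_enum.
rewrite cardsE (card_uniqP _) ?take_uniq ?enum_uniq // size_takel //.
by rewrite -cardE.
Qed.

Section Core.
Variables (p : nat) (p_pr : prime p) (n : nat).
Variables (J : finType) (lam : J -> option 'F_p).
Local Notation F := 'F_p.
Local Notation q := (p ^ n.+1)%N.
Local Notation c := (4 * p ^ n)%N.
Local Notation form S := (\prod_(j in S) line_form (lam j)).
Implicit Types (A B S K : {set J}).

Definition fibre S l := [set j in S | lam j == l].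

Lemma q_gt0 : (0 < q)%N. Proof. by rewrite expn_gt0 prime_gt0. Qed.
Lemma P_gt0 : (0 < p ^ n)%N. Proof. by rewrite expn_gt0 prime_gt0. Qed.

Lemma form_setU1 j S : j \notin S -> form (j |: S) = form S * line_form (lam j).
Proof. by move=> jS; rewrite big_setU1 //= mulrC. Qed.

Lemma size_form S : (size (form S)%R <= #|S|.+1)%N.
Proof.
rewrite -sum1_card; apply: size_prod_le => j _; exact: size_line_form.
Qed.

Lemma coef_form_big_fibre l : (q.-1 <= #|fibre setT l|)%N ->
  (q.-1 <= #|~: fibre setT l|)%N ->
  exists2 S : {set J}, #|S| = (q.-1 + q.-1)%N & (form S)`_q.-1 != 0.
Proof.
move=> /subset_of_card[A As Ac] /subset_of_card[B Bs Bc].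
have dAB : [disjoint A & B].
  by rewrite -setI_eq0 -subset0 -(setICr (fibre setT l)) setISS.
exists (A :|: B); first by rewrite cardsU disjoint_setI0 // cards0 subn0 Ac Bc.
rewrite (eq_bigl [predU A & B]) => [|j]; last by rewrite !inE.
rewrite bigU //=.
have -> : form A = line_form l ^+ q.-1.
  rewrite -Ac -prodr_const; apply: eq_bigr => j /(subsetP As).
  by rewrite !inE => /eqP ->.
have lB j : j \in B -> lam j != l by move=> /(subsetP Bs); rewrite !inE.
have sB : (size (form B)%R <= q.-1.+1)%N.
  by rewrite -Bc size_form.
case: l {As Bs} lB => [t|] lB /=; last first.
  have {2}<- : (size (form B)).-1 = q.-1.
    rewrite -Bc size_prod => [|j _]; last exact: line_form_neq0.
    under eq_bigr => j /lB; first by case: (lam j) => [t|] //= _; rewrite size_XsubC over.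
    by rewrite sum_nat_const muln2 -addnn subSn ?leq_addl // addnK.
  rewrite expr1n mul1r -lead_coefE lead_coef_eq0.
  by apply/prodf_neq0 => j _; apply: line_form_neq0.
have /factor_theorem[Q QE] : root (form B - (form B).[t]%:P) t.
  by rewrite /root !hornerE subrr.
have sQ : (size Q <= q.-1)%N.
  have : (size (Q * ('X - t%:P))%R <= q.-1.+1)%N.
    by rewrite -QE (leq_trans (size_polyD _ _)) // size_polyN geq_max sB (leq_trans (size_polyC_leq1 _)).
  have [->|Q0] := eqVneq Q 0; first by rewrite size_poly0.
  by rewrite size_Mmonic ?monicXsubC // size_XsubC addn2.
have -> : ('X - t%:P) ^+ q.-1 * form B =
    (form B).[t] *: ('X - t%:P) ^+ q.-1 + Q * 'X^q - t ^+ q *: Q.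
  have : form B = (form B).[t]%:P + Q * ('X - t%:P) by rewrite -QE addrC subrK.
  have TE : ('X - t%:P) ^+ q.-1 * ('X - t%:P) = 'X^q - (t ^+ q)%:P :> {poly F}.
    rewrite -exprSr prednK ?q_gt0 // expr_poly_Fp // comp_polyB comp_polyX comp_polyC.
    by rewrite expr_FpX.
  move: (form B).[t] => b ->.
  have -> : ('X - t%:P) ^+ q.-1 * (b%:P + Q * ('X - t%:P)) =
      b%:P * ('X - t%:P) ^+ q.-1 + Q * (('X - t%:P) ^+ q.-1 * ('X - t%:P)).
    by ring.
  by rewrite TE -!mul_polyC; ring.
rewrite coefB coefD coefMXn ltn_predL q_gt0 addr0 !coefZ [Q`_ _]nth_default //.
rewrite mulr0 subr0.
have -> : (('X - t%:P) ^+ q.-1)`_q.-1 = 1.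
  have := monic_exp q.-1 (monicXsubC t); rewrite monicE lead_coefE size_exp_XsubC.
  by move/eqP.
rewrite mulr1 horner_prod; apply/prodf_neq0 => j /lB.
by case: (lam j) => [u|] /=; rewrite ?hornerXsubC ?hornerC ?oner_eq0 // subr_eq0 => /eqP ut; apply: contra_notN ut => /eqP ->.
Qed.

Lemma fibreS A B l : A \subset B -> fibre A l \subset fibre B l.
Proof.
by move=> /subsetP AB; apply/subsetP => j; rewrite !inE => /andP[/AB -> ->].
Qed.

Lemma sum_card_fibre A : (\sum_l #|fibre A l| = #|A|)%N.
Proof.
rewrite -sum1_card (partition_big lam xpredT) //=; apply: eq_bigr => l _.
by rewrite -sum1dep_card; apply: eq_bigl => j; rewrite ?inE.
Qed.

Lemma form_fibre S : form S = \prod_l line_form l ^+ #|fibre S l|.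
Proof.
rewrite (partition_big lam xpredT) //=; apply: eq_bigr => l _.
rewrite -prodr_const; apply: eq_big => [j|j /andP[_ /eqP-> //]].
by rewrite inE.
Qed.

Lemma form_extension_mem K S :
  (forall A, A \subset K -> #|A| = (q.-1 + q.-1)%N -> (form A)`_q.-1 = 0) ->
  S \subset K -> (#|S| <= q.-1 + q.-1)%N -> #|K| = (q.-1 + q.-1 + c)%N ->
  (forall l, #|fibre (K :\: S) l| <= c)%N -> mem_powers q #|S| (form S).
Proof.
move=> K0 SK Sq Kc; have q0 := q_gt0.
have [k] := ubnP (q.-1 + q.-1 - #|S|); elim: k S SK Sq => // k IH S SK Sq Sk Sc.
have [Se|Sne] := eqVneq #|S| (q.-1 + q.-1)%N.
  move=> j jq Sj; have -> : j = q.-1 by lia.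
  exact: K0.
have step j : j \in K :\: S -> mem_powers q #|S|.+1 (form S * line_form (lam j)).
  rewrite inE => /andP[jS jK]; rewrite -form_setU1 //.
  have := cardsU1 j S; rewrite jS add1n => cS; rewrite -cS.
  apply: IH; rewrite ?cS; [|lia|lia|].
    by rewrite subUset sub1set jK.
  move=> l; apply: leq_trans (Sc l); apply/subset_leq_card/fibreS.
  by rewrite setDS // subsetUr.
have KS : #|K :\: S| = (#|K| - #|S|)%N by rewrite cardsDS.
have [|[j1 j1K]] := set_0Vmem (K :\: S).
  by move/eqP; rewrite -cards_eq0 KS; lia.
have : ~~ (K :\: S \subset fibre (K :\: S) (lam j1)).
  by apply/negP => /subset_leq_card; have := Sc (lam j1); rewrite KS; lia.
case/subsetPn => j2 j2K; rewrite inE j2K /= => j21.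
by apply: mem_powers_socle j21 (step _ j2K) (step _ j1K); lia.
Qed.

Lemma coef_form_small_fibres K : #|K| = (q.-1 + q.-1 + c)%N ->
  (forall l, #|fibre K l| < q)%N ->
  exists2 A : {set J}, #|A| = (q.-1 + q.-1)%N & (form A)`_q.-1 != 0.
Proof.
move=> Kc Kq; have q0 := q_gt0; have P0 := P_gt0.
pose good A := [&& A \subset K, #|A| == (q.-1 + q.-1)%N & (form A)`_q.-1 != 0].
have [/existsP[A /and3P[_ /eqP]]|] := boolP [exists A, good A]; first by exists A.
rewrite negb_exists => /forallP bad; exfalso.
have K0 A : A \subset K -> #|A| = (q.-1 + q.-1)%N -> (form A)`_q.-1 = 0.
  by move=> AK Aq; apply/eqP; move: (bad A); rewrite /good AK Aq eqxx negbK.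
pose thin (S : {set J}) := (S \subset K) && [forall l, #|fibre (K :\: S) l| <= c]%N.
have thinK : thin K.
  rewrite /thin subxx setDv; apply/forallP => l; rewrite (@eq_card0 _ (fibre _ _)) // => j.
  by rewrite !inE.
case: (arg_minnP (fun S : {set J} => #|S|) thinK) => S /andP[SK /forallP Sc] Smin.
have full l : (0 < #|fibre S l|)%N -> (#|fibre (K :\: S) l| = c)%N.
  rewrite card_gt0 => /set0Pn[j]; rewrite inE => /andP[jS /eqP jl].
  apply/eqP; rewrite eqn_leq Sc leqNgt; apply/negP => lt_c.
  have : ~~ thin (S :\ j).
    by apply/negP => /Smin; rewrite (cardsD1 j S) jS; lia.
  rewrite /thin (subset_trans (subsetDl _ _) SK) /=; case/forallPn => l'.
  have sub : fibre (K :\: (S :\ j)) l' \subset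
      (if l' == l then j |: fibre (K :\: S) l else fibre (K :\: S) l').
    apply/subsetP => i; case: (l' =P l) => [->|/eqP ll']; rewrite !inE.
      by case: (i =P j).
    by case: (i =P j) => // ->; rewrite jl eq_sym (negPf ll') !andbF.
  rewrite -ltnNge => /leq_trans /(_ (subset_leq_card sub)).
  case: ifP => _; last by have := Sc l'; lia.
  by rewrite cardsU1; case: (j \notin _) => /=; lia.
have KS : #|K :\: S| = (#|K| - #|S|)%N by rewrite cardsDS.
have SKc := subset_leq_card SK.
pose m := #|[set l | (0 < #|fibre S l|)%N]|.
have mc : (m * c <= #|K :\: S|)%N.
  rewrite -sum_card_fibre /m -sum_nat_const big_mkcond /=; apply: leq_sum => l _.
  by rewrite inE; case: ifP => // /full ->.
have SK_fibre l : (#|fibre S l| + #|fibre (K :\: S) l| = #|fibre K l|)%N.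
  have -> : fibre (K :\: S) l = fibre K l :\: fibre S l.
    by apply/setP => j; rewrite !inE; case: (lam j == l); rewrite ?andbF ?andbT.
  by rewrite cardsDS ?fibreS // subnKC // subset_leq_card ?fibreS.
have Sq : (#|S| <= q.-1 + q.-1)%N.
  have [->|[j jS]] := set_0Vmem S; first by rewrite cards0.
  suff : (0 < m)%N by move: mc; rewrite KS Kc; case: (m) => // m' mc _; nia.
  rewrite card_gt0; apply/set0Pn; exists (lam j); rewrite inE card_gt0.
  by apply/set0Pn; exists j; rewrite inE jS eqxx.
have := form_extension_mem K0 SK Sq Kc Sc.
rewrite form_fibre -sum_card_fibre; apply: mem_powers_lines => // [l l0|].
  by have := SK_fibre l; rewrite (full _ l0) => ->.
by rewrite sum_card_fibre -/m; move: mc; rewrite KS Kc; lia.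
Qed.

Lemma coef_form_exists : (q.-1 + q.-1 + c <= #|J|)%N ->
  (forall l, q.-1 <= #|~: fibre setT l|)%N ->
  exists2 A : {set J}, #|A| = (q.-1 + q.-1)%N & (form A)`_q.-1 != 0.
Proof.
move=> Jc Jl; have q0 := q_gt0.
have [/existsP[l ql]|] := boolP [exists l, q.-1 <= #|fibre setT l|]%N.
  exact: coef_form_big_fibre (Jl l).
rewrite negb_exists => /forallP small.
have [|K _ Kc] := @subset_of_card _ [set: J] (q.-1 + q.-1 + c); first by rewrite cardsT.
apply: (coef_form_small_fibres Kc) => l.
have := subset_leq_card (fibreS l (subsetT K)); have := small l; lia.
Qed.

End Core.

(** * Weighted zero sums in (Z/q)^2 *)

Lemma divided_difference (F : fieldType) (s : seq F) : uniq s -> s != [::] ->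
  exists c : F -> F, forall P : {poly F}, (size P <= size s)%N ->
    \sum_(x <- s) c x * P.[x] = P`_(size s).-1.
Proof.
elim: s => // x0 [|x1 s] IH.
  move=> _ _; exists (fun=> 1) => P sP.
  by rewrite big_seq1 mul1r [P]size1_polyC // hornerC coefC.
rewrite cons_uniq => /andP[x0s us] _; have [c cP] := IH us isT.
set s1 := x1 :: s in x0s us cP *.
exists (fun x => if x == x0 then - \sum_(y <- s1) c y / (y - x0) else c x / (x - x0)).
move=> P sP; have /factor_theorem[Q QE] : root (P - P.[x0]%:P) x0.
  by rewrite /root !hornerE subrr.
have PE : P = Q * ('X - x0%:P) + P.[x0]%:P by rewrite -QE subrK.
have sQ : (size Q <= size s1)%N.
  have : (size (Q * ('X - x0%:P))%R <= (size s1).+1)%N.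
    rewrite -QE (leq_trans (size_polyD _ _)) // size_polyN geq_max sP.
    by rewrite (leq_trans (size_polyC_leq1 _)).
  have [->|Q0] := eqVneq Q 0; first by rewrite size_poly0.
  by rewrite size_Mmonic ?monicXsubC // size_XsubC addn2.
have -> : P`_(size (x0 :: s1)).-1 = Q`_(size s1).-1.
  by rewrite PE coefD coefC /= addr0 mulrBr coefB coefMX coefMC /= [Q`_ _.+1]nth_default // mul0r subr0.
rewrite -(cP Q sQ) big_cons eqxx mulNr big_distrl /= addrC.
apply/eqP; rewrite subr_eq -big_split /=; apply/eqP/eq_big_seq => x xs1.
have xx0 : x - x0 != 0 by rewrite subr_eq0; apply: contraNneq x0s => <-.
have -> : P.[x] = Q.[x] * (x - x0) + P.[x0] by rewrite {1}PE !hornerE.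
by rewrite -subr_eq0 (negPf xx0); field.
Qed.

Lemma ffact_natr (R : nzRingType) h j :
  (h ^_ j)%:R = \prod_(0 <= k < j) (h%:R - k%:R) :> R.
Proof.
elim: j => [|j IH]; first by rewrite big_nil.
rewrite big_nat_recr //= ffactnSr natrM IH; have [jh|hj] := leqP j h.
  by rewrite natrB.
by rewrite -IH ffact_small // !mul0r.
Qed.

Lemma one_addX_expr (R : comNzRingType) (u : {poly R}) n :
  exists2 G, (1 + 'X * u) ^+ n = 1 + 'X * G & G`_0 = u`_0 *+ n.
Proof.
elim: n => [|n [G GE G0]]; first by exists 0; rewrite ?mulr0 ?addr0 ?coef0.
exists (G + u + 'X * u * G); first by rewrite exprS GE; ring.
by rewrite !coefD -mulrA coefXM /= addr0 G0 mulrSr.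
Qed.

Lemma one_addX_mulG (R : comNzRingType) (y : R) h M : (h < M)%N ->
  (1 + y) ^+ h = \sum_(j < M) y ^+ j *+ 'C(h, j).
Proof.
move=> hM; rewrite exprDn (big_ord_widen M (fun i => 1 ^+ (h - i) * y ^+ i *+ 'C(h, i))) //.
rewrite big_mkcond /=; apply: eq_bigr => j _; rewrite expr1n mul1r.
by case: ltnP => // hj; rewrite bin_small.
Qed.

Lemma coef_one_addX_expr (R : comNzRingType) (c : R) m j :
  ((1 + 'X * c%:P) ^+ m)`_j = c ^+ j *+ 'C(m, j).
Proof.
rewrite (@one_addX_mulG _ _ _ (m + j).+1) ?ltnS ?leq_addr // coef_sum.
have jm : (j < (m + j).+1)%N by rewrite ltnS leq_addl.
rewrite (bigD1 (Ordinal jm)) //= big1 ?addr0 => [|i].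
  by rewrite exprMn -polyC_exp coefMn coefMC coefXn eqxx mul1r.
rewrite -val_eqE eq_sym => /negPf /= ij.
by rewrite exprMn -polyC_exp coefMn coefMC coefXn ij mul0r mul0rn.
Qed.

Section Binomial.
Variables (p : nat) (p_pr : prime p).
Local Notation F := 'F_p.

Lemma binomial_Fp_dvdn n m : 'C(m + (p ^ n).-1, (p ^ n).-1)%:R != 0 :> F ->
  (p ^ n %| m)%N.
Proof.
set q := (p ^ n)%N; have q0 : (0 < q)%N by rewrite expn_gt0 prime_gt0.
have coefB k j := coef_one_addX_expr (1 : F) k j.
apply: contraR => qm; have v0 : (0 < m %% q)%N by rewrite lt0n.
have -> : 'C(m + q.-1, q.-1)%:R = ((1 + 'X * 1%:P) ^+ (m + q.-1))`_q.-1 :> F.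
  by rewrite coefB expr1n.
rewrite polyC1 mulr1 (divn_eq m q).
have -> : (m %/ q * q + m %% q + q.-1 = q * (m %/ q).+1 + (m %% q).-1)%N by nia.
rewrite exprD exprM expr_poly_Fp // comp_polyD comp_polyX comp_polyC -/q.
have geom (Y : {poly F}) k : (1 + Y) ^+ k = 1 + Y * \sum_(i < k) (1 + Y) ^+ i.
  by have := subrX1 (1 + Y) k; rewrite addrAC subrr add0r => <-; rewrite addrCA subrr addr0.
rewrite polyC1 (geom 'X^q) mulrDl mul1r coefD -mulrA coefXnM ltn_predL q0 addr0.
rewrite -['X]mulr1 -polyC1 coefB bin_small ?mulr0n //.
by have := ltn_pmod m q0; lia.
Qed.

Lemma sum_support (V : nmodType) (s : seq nat) M (f : nat -> V) : uniq s ->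
  (forall h, h \in s -> (h < M)%N) ->
  \sum_(h < M) (if (h : nat) \in s then f h else 0) = \sum_(h <- s) f h.
Proof.
move=> us sM; rewrite -(big_mkord xpredT (fun h => if h \in s then f h else 0)).
rewrite -big_mkcond /= -big_filter; apply: perm_big; apply: uniq_perm => //.
  by rewrite filter_uniq // iota_uniq.
move=> h; rewrite mem_filter mem_index_iota /=.
by case: (boolP (h \in s)) => // /sM ->.
Qed.

Lemma fact_Fp_neq0 j : (j < p)%N -> j`!%:R != 0 :> F.
Proof.
elim: j => [|j IH] jp; first by rewrite oner_eq0.
rewrite factS natrM mulf_neq0 ?IH //; last by lia.
by apply/eqP => /(@natr_Fp_inj _ p_pr j.+1 0 jp (prime_gt0 p_pr)).
Qed.

Lemma local_factor (B : seq nat) e (G : {poly {poly F}}) :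
  uniq [seq h%:R : F | h <- B] -> (e < size B)%N ->
  exists2 c : nat -> F, (forall h, c h != 0 -> h \in B) &
    forall M, (forall h, h \in B -> (h < M)%N) ->
    exists k : F, exists2 H : {poly {poly F}}, k != 0 /\ H`_0 = k%:P * G`_0 ^+ e &
      \sum_(h < M) (c h)%:P%:P * (1 + 'X * G) ^+ h = 'X^e * H.
Proof.
move=> uB eB; pose s := take e.+1 B.
have ss : size s = e.+1 by rewrite size_takel.
have us : uniq [seq h%:R : F | h <- s] by rewrite map_take take_uniq.
have sB h : h \in s -> h \in B by apply: mem_take.
have [|d dP] := divided_difference us; first by rewrite -size_eq0 size_map ss.
rewrite size_map ss /= in dP.
exists (fun h => if h \in s then d h%:R else 0) => [h|M BM].
  by case: ifP => [/sB //|]; rewrite eqxx.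
have sM h : h \in s -> (h < M)%N by move/sB; apply: BM.
have eM : (e < M)%N.
  have : (size s <= size (iota 0 M))%N.
    apply: uniq_leq_size; first exact: map_uniq us.
    by move=> h /sM; rewrite mem_iota.
  by rewrite ss size_iota.
have ep : (e < p)%N.
  rewrite (leq_trans eB) // -(size_map (fun h => h%:R : F)) -(card_uniqP uB).
  by rewrite (leq_trans (max_card _)) // card_Fp.
pose sg j : F := \sum_(h <- s) d h%:R * 'C(h, j)%:R.
have sgP j : (j <= e)%N -> sg j * j`!%:R = (j == e)%:R.
  move=> je; pose P : {poly F} := \prod_(0 <= k < j) ('X - k%:R%:P).
  have sP : size P = j.+1 by rewrite size_prod_XsubC size_iota subn0.
  have := dP P; rewrite sP big_map => /(_ je).
  have -> : P`_e = (j == e)%:R.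
    have [<-|jne] := eqVneq j e; last by rewrite nth_default // sP; lia.
    have /monicP : P \is monic by apply: monic_prod_XsubC.
    by rewrite lead_coefE sP.
  move=> <-; rewrite big_distrl /=; apply: eq_bigr => h _.
  rewrite -mulrA -natrM bin_ffact ffact_natr horner_prod; congr (_ * _).
  by apply: eq_bigr => k _; rewrite hornerXsubC.
exists (sg e), (\sum_(j < M | (e <= j)%N) (sg j)%:P%:P * 'X^(j - e) * G ^+ j).
  have := sgP e (leqnn e); rewrite eqxx => sge; split.
    by apply/eqP => sg0; move/eqP: sge; rewrite sg0 mul0r eq_sym oner_eq0.
  rewrite coef_sum (bigD1 (Ordinal eM)) //= subnn expr0 mulr1.
  rewrite big1 ?addr0 => [|j /andP[ej]]; last first.
    rewrite -val_eqE /= => jne; rewrite -horner_coef0 !hornerM hornerXn expr0n.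
    by rewrite (_ : (j - e == 0)%N = false) ?mulr0 ?mul0r //; lia.
  by rewrite -!horner_coef0 hornerM hornerC horner_exp.
have -> : \sum_(h < M) (if (h : nat) \in s then d h%:R else 0)%:P%:P * (1 + 'X * G) ^+ h
   = \sum_(j < M) (sg j)%:P%:P * ('X * G) ^+ j.
  transitivity (\sum_(h < M) \sum_(j < M)
      (if (h : nat) \in s then (d h%:R * 'C(h, j)%:R)%:P%:P * ('X * G) ^+ j else 0)).
    apply: eq_bigr => h _; case: ifP => _; last by rewrite big1 // !polyC0 mul0r.
    rewrite (one_addX_mulG _ (ltn_ord h)) big_distrr; apply: eq_bigr => j _ /=.
    by rewrite -[_ *+ 'C(_, _)]mulr_natr !polyCM !polyC_natr; ring.
  rewrite exchange_big; apply: eq_bigr => j _.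
  rewrite (sum_support (fun h => (d h%:R * 'C(h, j)%:R)%:P%:P * ('X * G) ^+ j)) //; last exact: map_uniq us.
  by rewrite -big_distrl /sg !rmorph_sum.
rewrite big_distrr /= [RHS]big_mkcond; apply: eq_bigr => j _; case: leqP => ej.
  have -> : ('X * G) ^+ j = 'X^e * 'X^(j - e) * G ^+ j by rewrite exprMn -exprD subnKC.
  by ring.
have := sgP j (ltnW ej); rewrite (ltn_eqF ej).
move/eqP; rewrite mulf_eq0; case/orP => /eqP.
  by move=> ->; rewrite !polyC0 mul0r.
by move/eqP; rewrite (negPf (fact_Fp_neq0 (ltn_trans ej ep))).
Qed.

End Binomial.

Definition line_of (F : fieldType) (x y : F) : option F :=
  if x == 0 then None else Some (- y / x).

Lemma line_ofE (F : fieldType) (x y : F) : ~~ ((x == 0) && (y == 0)) ->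
  exists2 k : F, k != 0 & x *: 'X + y%:P = k *: line_form (line_of x y).
Proof.
rewrite /line_of; have [->|x0] /= := eqVneq x 0 => y0.
  by exists y => //; rewrite scale0r add0r -mul_polyC mulr1.
exists x => //; rewrite scalerBr; congr (_ + _).
by rewrite -mul_polyC -polyCM -polyCN mulNr mulrN opprK mulrC divfK.
Qed.

Section ZeroSum.
Variables (p : nat) (p_pr : prime p).
Local Notation F := 'F_p.
Local Notation R2 := {poly {poly F}}.

(* [X = x T] and [Y = T], so that the coefficient of [T ^ N] is the homogeneous
   part of degree [N], dehomogenised at [Y = 1]. *)
Local Notation xT := ('X * ('X : {poly F})%:P : R2).
Local Notation T := ('X * 1%:P : R2).

Lemma coef_two_powers m1 m2 N k : (k <= N)%N ->
  ((1 + xT) ^+ m1 * (1 + T) ^+ m2)`_N`_k = ('C(m1, k) * 'C(m2, N - k))%:R.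
Proof.
move=> kN; rewrite coefM coef_sum.
have kN1 : (k < N.+1)%N by rewrite ltnS.
rewrite (bigD1 (Ordinal kN1)) //= big1 ?addr0 => [|i]; rewrite !coef_one_addX_expr.
  by rewrite expr1n mulrnAl mulrnAr mulr1 !coefMn coefXn eqxx -mulrnA mulnC.
rewrite -val_eqE eq_sym => /negPf /= ik.
by rewrite expr1n mulrnAl mulrnAr mulr1 !coefMn coefXn ik !mul0rn.
Qed.

Lemma group_element_expand a b : exists2 G : R2,
  (1 + xT) ^+ a * (1 + T) ^+ b = 1 + 'X * G & G`_0 = a%:R *: 'X + b%:R%:P.
Proof.
have [G1 -> E1] := one_addX_expr ('X%:P : R2) a.
have [G2 -> E2] := one_addX_expr (1%:P : R2) b.
exists (G1 + G2 + 'X * G1 * G2); first by ring.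
rewrite !coefD -mulrA coefXM /= addr0 E1 E2 !coefC eqxx.
by rewrite polyC_natr scaler_nat.
Qed.

Lemma weighted_zero_sum n (I : finType) (a b : I -> nat) (B : I -> seq nat)
    (q := (p ^ n.+1)%N) (w := fun i => (size (B i)).-1) :
  (forall i, ~~ (((a i)%:R == 0 :> F) && ((b i)%:R == 0 :> F))) ->
  (forall i, uniq [seq h%:R : F | h <- B i]) -> (forall i, 0 < size (B i))%N ->
  (q.-1 + q.-1 + 4 * p ^ n <= \sum_i w i)%N ->
  (forall l : option F,
     q.-1 <= \sum_(i | line_of (a i)%:R (b i)%:R != l) w i)%N ->
  exists h : I -> nat, [/\ forall i, h i \in B i,
    (q %| \sum_i a i * h i)%N & (q %| \sum_i b i * h i)%N].
Proof.
move=> ab uB B0 wsum wline.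
pose lam i := line_of ((a i)%:R : F) (b i)%:R.
pose J := {i : I & 'I_(w i)}.
pose lamJ (j : J) := lam (tag j).
have q0 : (0 < q)%N by rewrite expn_gt0 prime_gt0.
have cardJ (P : pred I) : (\sum_(i | P i) w i)%N = #|[set j : J | P (tag j)]|.
  rewrite -sum1dep_card; under eq_bigr do rewrite -{1}[w _]card_ord -sum1_card.
  by rewrite sig_big_dep; apply: eq_bigl => j; rewrite andbT.
have [||A Aq Ane0] := @coef_form_exists p p_pr n J lamJ.
- by rewrite -cardsT; move: wsum; rewrite (cardJ predT).
- move=> l; have -> : ~: fibre lamJ setT l = [set j : J | lam (tag j) != l].
    by apply/setP => j; rewrite !inE.
  by rewrite -(cardJ (fun i => lam i != l)).
pose e i := #|[set j in A | tag j == i]|.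
have eB i : (e i < size (B i))%N.
  suff : (e i <= w i)%N by rewrite /w; have := B0 i; lia.
  rewrite -[w i]card_ord.
  apply: leq_trans (leq_imset_card (fun k : 'I_(w i) => Tagged (fun i => 'I_(w i)) k) _).
  apply/subset_leq_card/subsetP => -[i' k]; rewrite inE => /andP[_ /= /eqP ii'].
  by subst i'; apply: imset_f.
have esum : (\sum_i e i = q.-1 + q.-1)%N.
  rewrite -Aq -sum1_card (partition_big (fun j : J => tag j) xpredT) //=.
  by apply: eq_bigr => i _; rewrite /e -sum1dep_card; apply: eq_bigl => j; rewrite ?inE.
have Ae : \prod_(j in A) line_form (lamJ j) = \prod_i line_form (lam i) ^+ e i.
  rewrite (partition_big (fun j : J => tag j) xpredT) //=; apply: eq_bigr => i _.
  by rewrite -prodr_const; apply: eq_big => [j|j /andP[_ /eqP <-]]; rewrite ?inE.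
have /fin_all_exists2[G GE G0] i := group_element_expand (a i) (b i).
have /fin_all_exists2[k0 k00 k0E] i := line_ofE (ab i).
pose M := (\max_i \max_(h <- B i) h).+1.
have BM i h : h \in B i -> (h < M)%N.
  move=> hB; rewrite ltnS; apply: (@leq_trans (\max_(h <- B i) h)).
    exact: (@leq_bigmax_seq _ _ xpredT id).
  exact: (@leq_bigmax _ (fun i => \max_(h <- B i) h)).
have loc i : exists t : (nat -> F) * (F * R2),
    [/\ forall h, t.1 h != 0 -> h \in B i, t.2.1 != 0,
      t.2.2`_0 = t.2.1%:P * (G i)`_0 ^+ e i &
      \sum_(h < M) (t.1 h)%:P%:P * (1 + 'X * G i) ^+ h = 'X^(e i) * t.2.2].
  have [c cB cP] := local_factor p_pr (G i) (uB i) (eB i).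
  by have [k [H [k_0 H0] HE]] := cP M (BM i); exists (c, (k, H)).
have /fin_all_exists[t tP] := loc.
pose U : R2 := (1 + xT) ^+ q.-1 * (1 + T) ^+ q.-1.
pose W := U * \prod_i \sum_(h < M) ((t i).1 h)%:P%:P * (1 + 'X * G i) ^+ h.
have : W`_(q.-1 + q.-1)`_q.-1 != 0.
  have -> : W = 'X^(q.-1 + q.-1) * (U * \prod_i (t i).2.2).
    rewrite /W mulrCA -esum -prodrXr -big_split; congr (_ * _).
    by apply: eq_bigr => i _ /=; case: (tP i).
  rewrite coefXnM ltnn subnn -!horner_coef0 hornerM horner_prod.
  have -> : U.[0] = 1.
    by rewrite !(hornerM, hornerD, hornerX, hornerC, horner_exp) !mul0r addr0 !expr1n mulr1.
  rewrite mul1r (eq_bigr (fun i => ((t i).2.1 * k0 i ^+ e i)%:P * line_form (lam i) ^+ e i)); last first.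
    move=> i _; rewrite horner_coef0; have [_ _ -> _] := tP i.
    by rewrite G0 k0E -mul_polyC exprMn polyCM polyC_exp mulrA.
  rewrite big_split /= -rmorph_prod /= coefCM -Ae mulf_neq0 //.
  apply/prodf_neq0 => i _; have [_ t0 _ _] := tP i.
  by rewrite mulf_neq0 // expf_neq0.
rewrite /W bigA_distr_bigA big_distrr /= !coef_sum => Wne0.
have [f fP] : exists f : {ffun I -> 'I_M},
    (U * \prod_i (((t i).1 (f i))%:P%:P * (1 + 'X * G i) ^+ f i))`_(q.-1 + q.-1)`_q.-1 != 0.
  apply/existsP; apply: contraNT Wne0; rewrite negb_exists => /forallP H.
  by rewrite big1 // => f _; apply/eqP; rewrite -[_ == 0]negbK H.
exists (fun i => f i); move: fP.
have -> : U * \prod_i (((t i).1 (f i))%:P%:P * (1 + 'X * G i) ^+ f i) =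
    (\prod_i (t i).1 (f i))%:P%:P *
    ((1 + xT) ^+ (\sum_i a i * f i + q.-1) * (1 + T) ^+ (\sum_i b i * f i + q.-1)).
  rewrite big_split /= !rmorph_prod /= mulrCA; congr (_ * _).
  rewrite !exprD /U.
  have -> : \prod_i (1 + 'X * G i) ^+ f i =
      (1 + xT) ^+ (\sum_i a i * f i) * (1 + T) ^+ (\sum_i b i * f i).
    rewrite -!prodrXr -big_split; apply: eq_bigr => i _ /=.
    by rewrite -GE exprMn !exprM.
  by ring.
rewrite !coefCM coef_two_powers ?leq_addr // addnK mulf_eq0 negb_or natrM mulf_eq0 negb_or.
case/andP => /prodf_neq0 cf /andP[C1 C2]; split.
- by move=> i; have [tB _ _ _] := tP i; apply/tB/cf.
- exact: binomial_Fp_dvdn C1.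
- exact: binomial_Fp_dvdn C2.
Qed.

End ZeroSum.

Section PowerResidues.
Variables (p : nat) (p_pr : prime p).
Local Notation F := 'F_p.

Lemma card_expr_fibre m (y : F) : (0 < m)%N -> (#|[set x : F | x ^+ m == y]| <= m)%N.
Proof.
move=> m0; have sP : size ('X^m - y%:P) = m.+1 by rewrite size_XnsubC.
have P0 : 'X^m - y%:P != 0 by rewrite -size_poly_gt0 sP.
rewrite -ltnS -sP cardE; apply: max_poly_roots (enum_uniq _) => //.
apply/allP => x; rewrite mem_enum inE => /eqP xy.
by rewrite /root !hornerE xy subrr.
Qed.

Lemma power_residues t m (d := (p ^ t * m)%N) : (0 < m)%N ->
  exists H : seq nat, [/\ uniq [seq h%:R : F | h <- H],
    forall h, h \in H -> exists2 z, h = (z ^ d)%N & ~~ (p %| z)%N,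
    forall h, h \in H -> h%:R != 0 :> F &
    (p ^ t * p.-1 <= d * size H)%N].
Proof.
move=> m0; pose N0 := [set x : F | x != 0]; pose Y := (fun x : F => x ^+ m) @: N0.
pose g (y : F) := odflt 0 [pick x : F | (x != 0) && (x ^+ m == y)].
have gP y : y \in Y -> g y != 0 /\ g y ^+ m = y.
  case/imsetP => x; rewrite inE => x0 yE; rewrite /g; case: pickP => [z /andP[z0 /eqP]//|].
  by move/(_ x); rewrite x0 yE eqxx.
pose h (y : F) := (g y ^ d)%N.
have hE y : y \in Y -> (h y)%:R = y :> F.
  move=> /gP[g0 gm]; rewrite /h natrX natr_Zp /d exprM expr_FpX //.
have sY : (p.-1 <= m * #|Y|)%N.
  have <- : #|N0| = p.-1.
    have := card_Fp p_pr; rewrite (cardD1 0) inE add1n => /(congr1 predn) /= <-.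
    by apply: eq_card => x; rewrite !inE andbT.
  rewrite mulnC -sum_nat_const -sum1_card (partition_big_imset (fun x : F => x ^+ m)) /=.
  apply: leq_sum => y _; rewrite sum1dep_card.
  apply: leq_trans (card_expr_fibre y m0); apply/subset_leq_card/subsetP => x.
  by rewrite !inE => /andP[_].
exists [seq h y | y <- enum Y]; split.
- rewrite -map_comp map_inj_in_uniq ?enum_uniq // => y y'; rewrite !mem_enum => yY y'Y /=.
  by rewrite !hE.
- move=> k /mapP[y]; rewrite mem_enum => /gP[g0 _] ->; exists (g y) => //.
  by rewrite (dvdn_pcharf (pchar_Fp p_pr)) natr_Zp.
- move=> k /mapP[y]; rewrite mem_enum => yY ->; rewrite hE //.
  by have [g0 <-] := gP y yY; rewrite expf_neq0.
by rewrite size_map -cardE /d -mulnA leq_mul2l sY orbT.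
Qed.
End PowerResidues.

(** * p-adic integers *)

Section Padic.
Variables (p : nat) (p_pr : prime p).
Local Notation Zp := (padic_int p_pr).
Implicit Types x y z w r u : Zp.

Lemma residue_at0 x : x 0%N = 0.
Proof. by rewrite residueE expn0 modz1. Qed.

Lemma residue_nat m k : (m%:R : Zp) k = (m%:Z %% (p ^ k)%N)%Z.
Proof.
elim: m => [|m IH]; first by rewrite residue0 mod0z.
by rewrite -natr1 residueD IH residue1 modzDm -PoszD addn1.
Qed.

Lemma residue_int (m : int) k : (m%:~R : Zp) k = (m %% (p ^ k)%N)%Z.
Proof.
case: m => m; first by rewrite -residue_nat.
by rewrite NegzE mulrNz residueN residue_nat modzNm.
Qed.

Lemma residueD_congr x x' y y' n : x n = x' n -> y n = y' n -> (x + y) n = (x' + y') n.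
Proof. by move=> xx yy; rewrite !residueD xx yy. Qed.

Lemma residueM_congr x x' y y' n : x n = x' n -> y n = y' n -> (x * y) n = (x' * y') n.
Proof. by move=> xx yy; rewrite !residueM xx yy. Qed.

Lemma residueN_congr x x' n : x n = x' n -> (- x) n = (- x') n.
Proof. by move=> xx; rewrite !residueN xx. Qed.

Lemma residue_horner_congr (P : {poly Zp}) x x' n : x n = x' n -> P.[x] n = P.[x'] n.
Proof.
move=> xx; elim/poly_ind: P => [|P c IH]; first by rewrite !horner0.
by rewrite !hornerE; apply: residueD_congr => //; apply: residueM_congr.
Qed.

Lemma residue_mulp_congr x x' n : x n = x' n -> (p%:R * x) n.+1 = (p%:R * x') n.+1.
Proof.
move=> xx; rewrite !residueM !residue_nat !modzMml; apply/eqP.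
rewrite eqz_mod_dvd -mulrBr expnS PoszM dvdz_mul2l ?prime_gt0 //; last first.
  by rewrite eqz_nat -lt0n prime_gt0.
by rewrite -eqz_mod_dvd !residue_leq // xx.
Qed.

Lemma contraction_fixpoint (f : Zp -> Zp) :
  (forall n x y, x n = y n -> (f x) n.+1 = (f y) n.+1) -> exists x, f x = x.
Proof.
move=> fc; pose u n := iter n f 0.
have uS n : (u n.+1) n = (u n) n.
  by elim: n => [|n IH]; rewrite ?residue_at0 //; apply: fc.
have hu n : ((u n.+1) n.+1 = (u n) n %[mod (p ^ n)%N])%Z.
  by rewrite residue_leq // uS residue_mod.
exists (padic_of p_pr hu); apply: padic_intP => -[|n]; first by rewrite !residue_at0.
rewrite (fc n _ (u n)) /= ?residue_mod //; exact.
Qed.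

Lemma padic_dvd n x : x n = 0 -> exists y, x = p%:R ^+ n * y.
Proof.
move=> xn; pose P k : int := (p ^ k)%N; have P0 k : P k != 0.
  by rewrite eqz_nat -lt0n expn_gt0 prime_gt0.
have PD k l : P (k + l)%N = P k * P l by rewrite /P expnD PoszM.
pose u m : int := (x (m + n)%N %/ P n)%Z.
have uE m : x (m + n)%N = u m * P n.
  by apply/esym/divzK/dvdz_mod0P; rewrite [LHS]residue_leq ?leq_addl.
have hu m : (u m.+1 = u m %[mod (p ^ m)%N])%Z.
  apply/eqP; rewrite eqz_mod_dvd -(@dvdz_mul2r (P n)) ?P0 //.
  rewrite mulrBl -!uE -PD addSn -eqz_mod_dvd residue_leq ?leqnSn //.
  by rewrite residue_mod.
exists (padic_of p_pr hu); apply: padic_intP => k.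
rewrite -natrX residueM residue_nat /= modzMml modzMmr mulrC -uE residue_leq ?leq_addr //.
Qed.

Lemma p_neq0 : p%:R != 0 :> Zp.
Proof.
apply/eqP => /(congr1 (fun x : Zp => x 2%N)); rewrite residue_nat residue0.
have p1 := prime_gt1 p_pr; rewrite modz_small => [[p0]|]; first by rewrite p0 in p1.
by rewrite /= ltz_nat expnS expn1 ltn_Pmull // prime_gt0.
Qed.

Lemma pX_neq0 n : p%:R ^+ n != 0 :> Zp.
Proof. by rewrite expf_neq0 ?p_neq0. Qed.

Lemma padic_unitE x : (x \is a GRing.unit) = (x 1%N != 0).
Proof.
apply/idP/idP => [xu|x1].
  apply/eqP => x1; have /(congr1 (fun x : Zp => x 1%N)) := mulVr xu.
  rewrite residueM x1 mulr0 mod0z residue1 modz_small //= ltz_nat expn1.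
  exact: prime_gt1.
have cop : coprimez (x 1%N) p.
  rewrite coprimezE /= coprime_sym prime_coprime //; apply: contra x1 => px.
  by rewrite -residue_mod; apply/eqP/dvdz_mod0P; rewrite expn1.
have [[u v] /= uv] := coprimezP _ _ cop.
have ux : (u%:~R * x) 1%N = (1 : Zp) 1%N.
  rewrite residueM residue_int modzMml residue1; apply/eqP; rewrite eqz_mod_dvd.
  by apply/dvdzP; exists (- v); rewrite expn1 -uv; ring.
have /padic_dvd[t] : (1 - u%:~R * x) 1%N = 0.
  by rewrite -[RHS](residue0 p_pr 1) -(subrr (1 : Zp)); apply/residueD_congr/residueN_congr.
rewrite expr1 => /eqP; rewrite subr_eq => /eqP tE.
have [|w wE] := @contraction_fixpoint (fun w => 1 + p%:R * (t * w)).
  move=> n w w' ww'; apply: residueD_congr => //; apply: residue_mulp_congr.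
  exact: residueM_congr.
apply/unitrP; exists (w * u%:~R); rewrite [x * _]mulrC -!mulrA.
have -> : w * (u%:~R * x) = 1.
  have -> : u%:~R * x = 1 - p%:R * t by rewrite [X in X - _]tE addrAC subrr add0r.
  by rewrite mulrBr mulr1 -{1}wE; ring.
by [].
Qed.

Lemma padic_linear_solve (c : Zp) (P : {poly Zp}) r : c \is a GRing.unit ->
  exists w, c * w + p%:R * P.[w] = r.
Proof.
move=> cu; have [|w wE] := @contraction_fixpoint (fun w => c^-1 * (r - p%:R * P.[w])).
  move=> n w w' ww'; apply: residueM_congr => //; apply: residueD_congr => //.
  by apply/residueN_congr/residue_mulp_congr/residue_horner_congr.
by exists w; rewrite -{1}wE mulVKr // subrK.
Qed.

Lemma natr_unit m : ((m%:R : Zp) \is a GRing.unit) = ~~ (p %| m)%N.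
Proof. by rewrite padic_unitE residue_nat expn1; congr (~~ _); apply/eqP/idP => [/dvdz_mod0P|pm] //; apply/dvdz_mod0P. Qed.

Section Roots.
Hypothesis p_odd : (2 < p)%N.

Lemma expr_one_add m x :
  (1 + x) ^+ m = 1 + m%:R * x + \sum_(2 <= i < m.+1) x ^+ i *+ 'C(m, i).
Proof.
rewrite exprDn; under eq_bigr do rewrite expr1n mul1r.
rewrite -(big_mkord xpredT (fun i => x ^+ i *+ 'C(m, i))).
case: m => [|m]; first by rewrite big_nat1 big_geq // bin0 mul0r !addr0.
rewrite big_ltn // big_ltn // bin0 bin1 expr0 expr1 addrA.
by rewrite mulr_natl.
Qed.

Lemma root_coprime m r : ~~ (p %| m)%N -> exists w : Zp, (1 + p%:R * w) ^+ m = 1 + p%:R * r.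
Proof.
move=> pm; pose P : {poly Zp} := \sum_(2 <= i < m.+1) ((p%:R : Zp) ^+ (i - 2) *+ 'C(m, i)) *: 'X^i.
have [w wE] := padic_linear_solve P r (etrans (natr_unit m) pm).
exists w; rewrite -wE expr_one_add -addrA; congr (_ + _).
rewrite mulrDr mulrCA; congr (_ + _); rewrite /P horner_sum !mulr_sumr.
apply: eq_big_nat => i /andP[i2 _]; rewrite hornerZ hornerXn exprMn.
by rewrite -{1}(subnKC i2) exprD !mulrnAl mulrnAr expr2; ring.
Qed.

Lemma root_p n r : exists w : Zp,
  (1 + p%:R ^+ n.+1 * w) ^+ p = 1 + p%:R ^+ n.+2 * r.
Proof.
pose P : {poly Zp} :=
  \sum_(2 <= i < p) ((p%:R : Zp) ^+ ((n.+1 * i) - n.+2) *+ ('C(p, i) %/ p)) *: 'X^i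
  + (p%:R : Zp) ^+ (n.+1 * p - n.+3) *: 'X^p.
have [w wE] := padic_linear_solve P r (unitr1 _).
exists w; rewrite -wE expr_one_add -addrA; congr (_ + _).
rewrite mul1r mulrDr mulrA -exprS; congr (_ + _).
rewrite big_nat_recr 1?ltnW //= binn mulr1n /P hornerD horner_sum !mulrDr !mulr_sumr.
congr (_ + _); last first.
  rewrite hornerZ hornerXn exprMn !mulrA -exprM -exprSr -exprD; congr (_ ^+ _ * _); nia.
apply: eq_big_nat => i /andP[i2 ip]; rewrite hornerZ hornerXn exprMn.
have /divnK {1}<- : (p %| 'C(p, i))%N by rewrite prime_dvd_bin //; lia.
rewrite mulrnA -exprM -[_ *+ p]mulr_natr -mulrnAl -[_ *+ (_ %/ p)]mulr_natr.
rewrite -[in RHS](mulr_natr (p%:R ^+ _)); set k := (_ %/ p)%:R.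
have -> : (n.+1 * i = n.+2 + (n.+1 * i - n.+2))%N by nia.
by rewrite addKn exprD; ring.
Qed.

Lemma root_pX t r : exists w : Zp, (1 + p%:R * w) ^+ (p ^ t) = 1 + p%:R ^+ t.+1 * r.
Proof.
elim: t r => [|t IH] r; first by exists r; rewrite !expr1.
have [r1 <-] := root_p t r; have [w wE] := IH r1.
by exists w; rewrite expnSr exprM wE.
Qed.

Lemma root_exists t m r : ~~ (p %| m)%N ->
  exists y : Zp, y ^+ (p ^ t * m) = 1 + p%:R ^+ t.+1 * r.
Proof.
move=> pm; have [w <-] := root_pX t r; have [y <-] := root_coprime w pm.
by exists (1 + p%:R * y); rewrite -exprM mulnC.
Qed.

End Roots.
End Padic.

Section Valuation.
Variables (p : nat) (p_pr : prime p).
Local Notation Zp := (padic_int p_pr).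
Local Notation V := (Zp * Zp)%type.
Implicit Types (x y : Zp) (u v w : V).

Definition scalev x v : V := (x * v.1, x * v.2).
Definition det2 u v : Zp := u.1 * v.2 - u.2 * v.1.
Definition primitive v := (v.1 \is a GRing.unit) || (v.2 \is a GRing.unit).

Lemma scalevA x y v : scalev x (scalev y v) = scalev (x * y) v.
Proof. by rewrite /scalev /= !mulrA. Qed.

Lemma scale1v v : scalev 1 v = v.
Proof. by case: v => a b; rewrite /scalev /= !mul1r. Qed.

Lemma scalev_eq0 x v : x != 0 -> (scalev x v == (0, 0)) = (v == (0, 0)).
Proof. by case: v => a b x0; rewrite /scalev !xpair_eqE /= !mulf_eq0 (negPf x0). Qed.

Lemma primitive_neq0 v : primitive v -> v != (0, 0).
Proof. by case: v => a b; apply: contraTneq => -[-> ->]; rewrite /primitive /= !unitr0. Qed.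

Lemma primitive_decomp v : v != (0, 0) ->
  exists n, exists2 w, primitive w & v = scalev (p%:R ^+ n) w.
Proof.
move=> v0; have [n] : exists n, (v.1 n.+1 != 0) || (v.2 n.+1 != 0).
  have nz x : x != 0 -> exists n, x n.+1 != 0.
    by move=> /padic_neq0[[|n] xn]; [rewrite residue_at0 in xn|exists n].
  have [/nz[n xn]|/nz[n xn]] : v.1 != 0 \/ v.2 != 0.
  - by case: v v0 => a b; rewrite xpair_eqE negb_and => /orP[]; [left|right].
  - by exists n; rewrite xn.
  - by exists n; rewrite xn orbT.
elim: n v v0 => [|n IH] v v0 vn.
  by exists 0%N, v; rewrite ?scale1v ?expr0 // /primitive !padic_unitE.
have [pv|] := boolP (primitive v); first by exists 0%N, v; rewrite ?expr0 ?scale1v.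
rewrite negb_or !padic_unitE !negbK => /andP[/eqP/padic_dvd[a aE] /eqP/padic_dvd[b bE]].
rewrite expr1 in aE bE; have vE : v = scalev p%:R (a, b) by rewrite /scalev -aE -bE; case: (v).
have ab0 : (a, b) != (0, 0) by rewrite -(scalev_eq0 _ (p_neq0 p_pr)) -vE.
have [|k [w pw abE]] := IH (a, b) ab0.
  apply: contraLR vn; rewrite negb_or !negbK aE bE => /andP[/eqP a0 /eqP b0].
  have z x : x n.+1 = 0 -> (p%:R * x) n.+2 = 0.
    by move=> x0; rewrite (@residue_mulp_congr _ _ _ 0) ?mulr0 ?residue0.
  by rewrite negb_or !negbK !z.
by exists k.+1, w => //; rewrite vE abE scalevA exprS.
Qed.

Definition nu v : nat :=
  if pselect (exists n, exists2 w, primitive w & v = scalev (p%:R ^+ n) w) is left e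
  then projT1 (cid e) else 0%N.

Lemma nuP v : v != (0, 0) -> exists2 w, primitive w & v = scalev (p%:R ^+ nu v) w.
Proof.
move=> /primitive_decomp e; rewrite /nu; case: pselect => // {}e.
by case: (cid e).
Qed.

Lemma primitive_scale_leq m n u v : primitive u ->
  scalev (p%:R ^+ m) u = scalev (p%:R ^+ n) v -> (n <= m)%N.
Proof.
move=> pu uv; have /= uv1 := congr1 fst uv; have /= uv2 := congr1 snd uv.
rewrite leqNgt; apply/negP => mn.
have nE : p%:R ^+ n = p%:R ^+ m * (p%:R * p%:R ^+ (n - m).-1) :> Zp.
  by rewrite -exprS -exprD; congr (_ ^+ _); lia.
have nunit x y : p%:R ^+ m * x = p%:R ^+ n * y -> x \isn't a GRing.unit.
  rewrite nE -mulrA => /(mulfI (pX_neq0 p_pr m)) ->.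
  by rewrite -mulrA unitrM natr_unit dvdnn.
by move: pu; rewrite /primitive (negPf (nunit _ _ uv1)) (negPf (nunit _ _ uv2)).
Qed.

Lemma nu_primitive n u : primitive u -> nu (scalev (p%:R ^+ n) u) = n.
Proof.
move=> pu; have [|w pw wE] := @nuP (scalev (p%:R ^+ n) u).
  by rewrite scalev_eq0 ?pX_neq0 // primitive_neq0.
apply/eqP; rewrite eqn_leq (primitive_scale_leq pu wE).
by rewrite (primitive_scale_leq pw (esym wE)).
Qed.

Lemma nu_scale n v : v != (0, 0) -> nu (scalev (p%:R ^+ n) v) = (n + nu v)%N.
Proof.
by move=> /nuP[w pw {1}->]; rewrite scalevA -exprD nu_primitive.
Qed.

Definition pval x : nat := nu (x, 0).

Lemma pvalP x : x != 0 -> exists2 y, y \is a GRing.unit & x = p%:R ^+ pval x * y.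
Proof.
move=> x0; have [|[y z] yu xzE] := @nuP (x, 0); first by rewrite xpair_eqE negb_and x0.
have /= xE := congr1 fst xzE; have /= zE := congr1 snd xzE.
exists y => //; move: yu; rewrite /primitive.
have -> : (y, z).2 = 0.
  by apply/eqP; move/eqP: zE; rewrite eq_sym mulf_eq0 (negPf (pX_neq0 p_pr _)).
by rewrite unitr0 orbF.
Qed.

Lemma pval_unit n y : y \is a GRing.unit -> pval (p%:R ^+ n * y) = n.
Proof.
move=> yu; rewrite /pval -[RHS](@nu_primitive n (y, 0)) /primitive ?yu //.
by rewrite /scalev mulr0.
Qed.

Lemma pvalM x y : x != 0 -> y != 0 -> pval (x * y) = (pval x + pval y)%N.
Proof.
move=> /pvalP[x' xu {1}->] /pvalP[y' yu {1}->].
by rewrite mulrACA -exprD pval_unit // unitrM xu.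
Qed.

Lemma nu_det u v : det2 u v != 0 -> (nu u + nu v <= pval (det2 u v))%N.
Proof.
move=> uv0.
have u0 : u != (0, 0).
  by apply: contraNneq uv0 => ->; rewrite /det2 !mul0r subrr.
have v0 : v != (0, 0).
  by apply: contraNneq uv0 => ->; rewrite /det2 !mulr0 subrr.
have [u' pu uE] := nuP u0; have [v' pv vE] := nuP v0.
have dE : det2 u v = p%:R ^+ (nu u + nu v) * det2 u' v'.
  rewrite {1}uE {1}vE exprD; set P := _ ^+ nu u; set Q := _ ^+ nu v; clearbody P Q.
  by rewrite /det2 /=; ring.
have d0 : det2 u' v' != 0 by apply: contraNneq uv0; rewrite dE => ->; rewrite mulr0.
rewrite dE pvalM ?pX_neq0 // -[X in pval X]mulr1 pval_unit ?unitr1 ?leq_addr //.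
Qed.

End Valuation.

(** * Normalisation of the system *)

Lemma semistable_sum (I : finType) (f : I -> nat) (par : rel I) K :
  (forall i j, ~~ par i j -> f i + f j <= K)%N ->
  (forall j, 2 * #|[set i | par i j]| <= #|I|)%N ->
  (2 * \sum_i f i <= #|I| * K)%N.
Proof.
move=> fK semi; have [I0|] := posnP #|I|.
  rewrite big1 // => i _; have /card0_eq/(_ i) := I0; by rewrite inE.
move=> /card_gt0P[i0 _]; have [j _ jmax] := arg_maxnP f (isT : predT i0).
have [fj|fj] := leqP (2 * f j) K.
  rewrite -sum_nat_const big_distrr; apply: leq_sum => i _ /=.
  by have := jmax i isT; lia.
pose L := [set i | par i j]; have cL := cardsC L; have := semi j; rewrite -/L.
have L1 : (\sum_(i in L) f i <= #|L| * f j)%N.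
  by rewrite -sum_nat_const; apply: leq_sum => i _; apply: jmax.
have L2 : (\sum_(i in ~: L) f i + #|~: L| * f j <= #|~: L| * K)%N.
  rewrite -!sum_nat_const -big_split; apply: leq_sum => i.
  by rewrite !inE => /fK.
rewrite (bigID (mem L)) /= [X in (_ + X)%N](eq_bigl (mem (~: L))) => [|i]; last by rewrite !inE.
rewrite -cL; move: (\sum_(i in L) _)%N (\sum_(i in ~: L) _)%N #|L| #|~: L| (f j) L1 L2 fj.
move=> A B n m F AF BF KF nm; have [k mE] : exists k, m = (n + k)%N.
  by exists (m - n)%N; lia.
by rewrite mE in BF *; nia.
Qed.

Lemma exists_minimizer (T : Type) (P : T -> Prop) (N : T -> nat) :
  (exists x, P x) -> exists2 x, P x & forall y, P y -> (N x <= N y)%N.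
Proof.
move=> [x0 Px0]; have ex : exists n, `[< exists2 x, P x & N x = n >].
  by exists (N x0); apply/asboolP; exists x0.
case: (ex_minnP ex) => n /asboolP[x Px <-] nmin.
by exists x => // y Py; apply: nmin; apply/asboolP; exists y.
Qed.

Section Normalisation.
Variables (p : nat) (p_pr : prime p).
Local Notation Zp := (padic_int p_pr).
Local Notation V := (Zp * Zp)%type.
Implicit Types (x y : Zp) (u v w r : V) (T : V * V).

Definition red x : 'F_p := (x 1%N)%:~R.

Lemma intr_modp (z : int) : (z %% p)%Z%:~R = z%:~R :> 'F_p.
Proof.
rewrite [in RHS](divz_eq z p); move: (z %/ p)%Z (z %% p)%Z => a b; rewrite intrD intrM.
by rewrite -[p%:Z%:~R]/(p%:R) (pcharf0 (pchar_Fp p_pr)) mulr0 add0r.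
Qed.

Lemma redD x y : red (x + y) = red x + red y.
Proof. by rewrite /red residueD expn1 intr_modp intrD. Qed.

Lemma redM x y : red (x * y) = red x * red y.
Proof. by rewrite /red residueM expn1 intr_modp intrM. Qed.

Lemma redN x : red (- x) = - red x.
Proof. by rewrite /red residueN expn1 intr_modp mulrNz. Qed.

Lemma red_nat n : red n%:R = n%:R.
Proof. by rewrite /red residue_nat expn1 intr_modp. Qed.

Lemma red_eq0 x : (red x == 0) = (x \isn't a GRing.unit).
Proof.
rewrite padic_unitE negbK /red; apply/idP/eqP => [|->]; last by rewrite eqxx.
case: (x 1%N) (residue_mod x 1) => n; rewrite expn1 => nE; last first.
  by have := modz_ge0 (Negz n) (_ : p%:Z != 0); rewrite nE => /(_ _)H; have := prime_gt0 p_pr; case: (p) H => // k /(_ isT).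
have np : (n < p)%N.
  by have := ltz_pmod n%:Z (_ : 0 < p%:Z); rewrite nE ltz_nat => -> //; apply: prime_gt0.
by move=> /eqP/(@natr_Fp_inj _ p_pr n 0 np (prime_gt0 p_pr)) ->.
Qed.

Definition dot r v : Zp := r.1 * v.1 + r.2 * v.2.
Definition act T v : V := (dot T.1 v, dot T.2 v).
Definition lineV w := line_of (red w.1) (red w.2).

Lemma det2_act T u v : det2 (act T u) (act T v) = det2 T.1 T.2 * det2 u v.
Proof. by rewrite /det2 /act /dot /=; ring. Qed.

Lemma act_eq0 T v : det2 T.1 T.2 != 0 -> act T v = (0, 0) -> v = (0, 0).
Proof.
move=> T0 Tv; have /= T1 := congr1 fst Tv; have /= T2 := congr1 snd Tv.
have v1 : det2 T.1 T.2 * v.1 = T.2.2 * dot T.1 v - T.1.2 * dot T.2 v.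
  by rewrite /det2 /dot; ring.
have v2 : det2 T.1 T.2 * v.2 = T.1.1 * dot T.2 v - T.2.1 * dot T.1 v.
  by rewrite /det2 /dot; ring.
rewrite T1 T2 !mulr0 subrr in v1 v2; case: v v1 v2 {Tv T1 T2} => a b /= v1 v2.
by congr (_, _); apply/eqP; [move/eqP: v1|move/eqP: v2]; rewrite mulf_eq0 (negPf T0).
Qed.

Definition squeeze d (l : option 'F_p) T : V * V :=
  if l is Some t then
    (scalev (p%:R ^+ d.+1) T.1,
     scalev (p%:R ^+ d) (T.2.1 + (t : nat)%:R * T.1.1, T.2.2 + (t : nat)%:R * T.1.2))
  else (scalev (p%:R ^+ d.+1) T.2, scalev (p%:R ^+ d) T.1).

Lemma det2_squeeze d l T : exists2 e : Zp, e \is a GRing.unit &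
  det2 (squeeze d l T).1 (squeeze d l T).2 = p%:R ^+ (2 * d + 1) * e * det2 T.1 T.2.
Proof.
have -> : p%:R ^+ (2 * d + 1) = p%:R ^+ d.+1 * p%:R ^+ d :> Zp.
  by rewrite -exprD; congr (_ ^+ _); lia.
case: l => [t|] /=; [exists 1|exists (-1)]; rewrite ?unitrN ?unitr1 //;
by rewrite /det2 /=; ring.
Qed.

Lemma nu_squeeze d l T v : det2 T.1 T.2 != 0 -> v != (0, 0) ->
  exists2 w, primitive w /\ act T v = scalev (p%:R ^+ nu (act T v)) w &
  (nu (act T v) + d + (lineV w == l) <= nu (act (squeeze d l T) v))%N.
Proof.
move=> T0 v0; have Tv0 : act T v != (0, 0) by apply: contra_neq v0; apply: act_eq0.
have T'v0 : act (squeeze d l T) v != (0, 0).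
  apply: contra_neq v0; apply: act_eq0; have [e eu ->] := det2_squeeze d l T.
  rewrite !mulf_neq0 ?pX_neq0 //; by apply: contraTneq eu => ->; rewrite unitr0.
have [w pw wE] := nuP Tv0; exists w => //.
set n := nu _ in wE *.
pose phi : Zp := if l is Some t then w.2 + (t : nat)%:R * w.1 else w.1.
pose psi : Zp := if l is Some t then w.1 else w.2.
have /= w1 := congr1 fst wE; have /= w2 := congr1 snd wE.
have E : act (squeeze d l T) v = scalev (p%:R ^+ (n + d)) (p%:R * psi, phi).
  rewrite /squeeze /phi /psi /act /scalev exprD; case: l {phi psi T'v0} => [t|] /=; congr (_, _).
  - transitivity (p%:R ^+ d.+1 * dot T.1 v); first by rewrite /dot /=; ring.
    rewrite w1 exprS; set P := _ ^+ n; set Q := _ ^+ d; clearbody P Q; ring.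
  - transitivity (p%:R ^+ d * (dot T.2 v + (t : nat)%:R * dot T.1 v)); first by rewrite /dot /=; ring.
    rewrite w1 w2; set P := _ ^+ n; set Q := _ ^+ d; set t' := (t : nat)%:R; clearbody P Q t'; ring.
  - transitivity (p%:R ^+ d.+1 * dot T.2 v); first by rewrite /dot /=; ring.
    rewrite w2 exprS; set P := _ ^+ n; set Q := _ ^+ d; clearbody P Q; ring.
  - transitivity (p%:R ^+ d * dot T.1 v); first by rewrite /dot /=; ring.
    rewrite w1; set P := _ ^+ n; set Q := _ ^+ d; clearbody P Q; ring.
case: eqP => [lE|_]; last first.
  move: T'v0; rewrite E scalev_eq0 ?pX_neq0 // => h; rewrite nu_scale // addn0.
  by rewrite leq_addr.
have : red phi = 0.
  rewrite /phi -lE /lineV /line_of; case: eqP => [//|/eqP x0].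
  rewrite redD redM red_nat natr_Zp mulNr mulNr divfK // subrr //.
move/eqP; rewrite red_eq0 padic_unitE negbK => /eqP/padic_dvd[z]; rewrite expr1 => zE.
have E' : act (squeeze d l T) v = scalev (p%:R ^+ (n + d + 1)) (psi, z).
  by rewrite E zE addn1 exprSr /scalev /= !mulrA.
move: T'v0; rewrite E' scalev_eq0 ?pX_neq0 // => h; rewrite nu_scale //.
by rewrite leq_addr.
Qed.

Lemma normalise (I : finType) (v : I -> V) d : (0 < d)%N ->
  (forall i, v i != (0, 0)) ->
  (forall j, 2 * #|[set i | (det2 (v i) (v j) == 0)%R]| <= #|I|)%N ->
  exists T (c : I -> nat) (w : I -> V) (I0 : {set I}), [/\ det2 T.1 T.2 != 0,
    forall i, i \in I0 -> primitive (w i) /\ act T (v i) = scalev (p%:R ^+ (d * c i)) (w i),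
    (#|I| <= d * #|I0|)%N &
    forall l, (#|I| <= 2 * d * #|[set i in I0 | lineV (w i) != l]|)%N].
Proof.
move=> d0 v0 semi; set s := #|I|.
pose C := (\sum_i \sum_j pval (det2 (v i) (v j)))%N.
pose n T i := nu (act T (v i)).
pose A T := (\sum_i 2 * d * (n T i %/ d))%N.
have bound T : det2 T.1 T.2 != 0 -> (A T <= s * (pval (det2 T.1 T.2) + C))%N.
  move=> T0; apply: leq_trans (semistable_sum (f := n T) _ semi).
    rewrite big_distrr; apply: leq_sum => i _ /=.
    by have := leq_divM (n T i) d; lia.
  move=> i j ij; apply: leq_trans (nu_det _) _; rewrite det2_act ?mulf_neq0 //.
  rewrite pvalM // leq_add2l /C (bigD1 i) //= (bigD1 j) //= -addnA leq_addr //.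
(* [C] only serves to make the potential a natural number. *)
pose N T := (s * (pval (det2 T.1 T.2) + C) - A T)%N.
have [|T T0 Tmin] := @exists_minimizer _ (fun T => det2 T.1 T.2 != 0) N.
  by exists ((1, 0), (0, 1)); rewrite /det2 /= mulr1 mulr0 subr0 oner_eq0.
pose c i := (n T i %/ d)%N.
have cmp T' k (g : I -> nat) : det2 T'.1 T'.2 != 0 ->
    pval (det2 T'.1 T'.2) = (pval (det2 T.1 T.2) + k)%N ->
    (forall i, c i + g i <= n T' i %/ d)%N -> (2 * d * \sum_i g i <= s * k)%N.
  move=> T'0 vT' cg; have := Tmin T' T'0; rewrite /N vT'.
  have := bound T T0; have := bound T' T'0; rewrite vT'.
  have : (A T + 2 * d * \sum_i g i <= A T')%N.
    rewrite /A big_distrr -big_split; apply: leq_sum => i _ /=.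
    by rewrite -mulnDr leq_mul2l cg orbT.
  rewrite !mulnDr; move: (A T) (A T') (2 * d * _)%N (s * _)%N (s * C)%N (s * k)%N.
  by lia.
have /fin_all_exists2[w pw wE] i : exists2 w, primitive w &
    act T (v i) = scalev (p%:R ^+ n T i) w.
  by apply: nuP; apply: contra_neq (v0 i); apply: act_eq0.
pose I0 := [set i | d %| n T i]%N.
have sumC (P : pred I) : (\sum_i (~~ P i) + #|[set i | P i]| = s)%N.
  have -> : #|[set i | P i]| = (\sum_i P i)%N.
    by rewrite -sum1dep_card big_mkcond; apply: eq_bigr => i _; case: (P i).
  by rewrite -big_split /s -sum1_card; apply: eq_bigr => i _ /=; case: (P i).
have nE i : n T i = (c i * d + n T i %% d)%N := divn_eq _ _.
exists T, c, w, I0; split => //.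
- move=> i; rewrite inE => di; split; first exact: pw.
  by rewrite wE {1}nE (eqP di) addn0 mulnC.
- pose T' : V * V := (scalev (p%:R ^+ d.-1) T.1, scalev (p%:R ^+ d.-1) T.2).
  have dE : det2 T'.1 T'.2 = (p%:R ^+ (2 * d.-1) * 1) * det2 T.1 T.2.
    by rewrite mul2n -addnn exprD /T' /det2 /=; ring.
  have := @cmp T' (2 * d.-1)%N (fun i => ~~ (d %| n T i))%N.
  rewrite dE mulf_neq0 ?mulr1 ?pX_neq0 // pvalM ?pX_neq0 // -[p%:R ^+ _]mulr1.
  rewrite pval_unit ?unitr1 // addnC => /(_ isT erefl).
  have := sumC (fun i => d %| n T i)%N; rewrite -/I0.
  move: (\sum_i _)%N #|I0| => a b ab /(_ _)H; suff : (2 * d * a <= s * (2 * d.-1))%N.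
    by rewrite -ab; case: (d) d0 => // k _ /=; nia.
  apply: H => i; have -> : n T' i = (d.-1 + n T i)%N.
    rewrite /n -nu_scale; last by apply: contra_neq (v0 i); apply: act_eq0.
    by congr nu; rewrite /act /scalev /dot /=; congr (_, _); ring.
  rewrite leq_divRL // {2}nE /dvdn.
  by have := nE i; case: eqP => /= h; rewrite ?addn0 ?addn1; lia.
move=> l; have [e eu dE] := det2_squeeze d.-1 l T.
have := @cmp (squeeze d.-1 l T) (2 * d.-1 + 1)%N (fun i => ~~ ((d %| n T i)%N && (lineV (w i) != l))).
have e0 : e != 0 by apply: contraTneq eu => ->; rewrite unitr0.
rewrite dE !mulf_neq0 ?pX_neq0 // pvalM ?mulf_neq0 ?pX_neq0 // pval_unit //.
rewrite addnC => /(_ isT erefl).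
have := sumC (fun i => (d %| n T i)%N && (lineV (w i) != l)).
have -> : [set i in I0 | lineV (w i) != l] = [set i | (d %| n T i)%N && (lineV (w i) != l)].
  by apply/setP => i; rewrite !inE.
move: (\sum_i _)%N #|[set i | _]| => a b ab /(_ _)H.
suff : (2 * d * a <= s * (2 * d.-1 + 1))%N.
  by rewrite -ab; case: (d) d0 => // k _ /=; nia.
apply: H => i; have [w' [pw' w'E]] := nu_squeeze d.-1 l T0 (v0 i).
have -> : w' = w i.
  move: w'E; rewrite wE /scalev nu_primitive // => E.
  have /= /(mulfI (pX_neq0 p_pr _)) E1 := congr1 fst E.
  have /= /(mulfI (pX_neq0 p_pr _)) E2 := congr1 snd E.
  by case: (w i) (w') E1 E2 => ? ? [? ?] /= -> ->.
rewrite -/(n T i) => h; rewrite leq_divRL //; apply: leq_trans h; rewrite {2}nE /dvdn.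
by have := nE i; case: eqP => /= h; case: eqP => /= _; rewrite ?addn0 ?addn1; lia.
Qed.

End Normalisation.

(** * Solving the normalised system *)

Section Solve.
Variables (p : nat) (p_pr : prime p).
Local Notation Zp := (padic_int p_pr).
Local Notation V := (Zp * Zp)%type.
Implicit Types (x y : Zp) (u v w : V).

Lemma det2_unit u v : primitive u -> primitive v -> lineV u != lineV v ->
  det2 u v \is a GRing.unit.
Proof.
rewrite /primitive -[_ \is a _]negbK -red_eq0 -[u.2 \is a _]negbK -red_eq0.
rewrite -[v.1 \is a _]negbK -red_eq0 -[v.2 \is a _]negbK -red_eq0.
rewrite -[det2 u v \is a _]negbK -red_eq0 /det2 redD redN !redM /lineV /line_of.
move: (red u.1) (red u.2) (red v.1) (red v.2) => x1 y1 x2 y2.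
have [->|x10] /= := eqVneq x1 0.
  rewrite mul0r sub0r oppr_eq0 mulf_eq0 => y10 _; rewrite (negPf y10) ?eqxx /=.
  by case: (x2 =P 0).
move=> _; have [->|x20] /= := eqVneq x2 0.
  by rewrite mulr0 subr0 mulf_eq0 (negPf x10).
move=> _; apply: contra; rewrite subr_eq0 => /eqP E.
by apply/eqP; congr Some; apply/eqP; rewrite !mulNr eqr_opp eqr_div // -E mulrC.
Qed.

Lemma red_residue x n : (`|x n.+1|%N)%:R = red x.
Proof.
have x0 : 0 <= x n.+1.
  by rewrite -residue_mod modz_ge0 // eqz_nat -lt0n expn_gt0 prime_gt0.
rewrite /red -(residue_leq x (leq_addr n 1)) add1n expn1 (intr_modp p_pr).
by rewrite -[in RHS](gez0_abs x0).
Qed.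

Lemma residue_sum_congr (I : finType) (f g : I -> Zp) n :
  (forall i, f i n = g i n) -> (\sum_i f i) n = (\sum_i g i) n.
Proof.
move=> fg; apply: (big_ind2 (fun x y : Zp => x n = y n)) => // x x' y y'.
exact: residueD_congr.
Qed.

Lemma residue_sum_dvd (I : finType) (f : I -> Zp) (g : I -> nat) n :
  (forall i, f i n = ((g i)%:R : Zp) n) -> (p ^ n %| \sum_i g i)%N ->
  exists r, \sum_i f i = p%:R ^+ n * r.
Proof.
move=> fg dv; apply: padic_dvd; rewrite (residue_sum_congr fg) -natr_sum residue_nat.
exact/dvdz_mod0P.
Qed.

Lemma natr_absz x n : ((`|x n|%N)%:R : Zp) n = x n.
Proof.
rewrite residue_nat gez0_abs ?residue_mod //.
by rewrite -residue_mod modz_ge0 // eqz_nat -lt0n expn_gt0 prime_gt0.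
Qed.

Lemma perturb_power d (x e y : Zp) : x ^+ d \is a GRing.unit ->
  y ^+ d = 1 + e * (x ^+ d)^-1 -> (x * y) ^+ d = x ^+ d + e.
Proof. by move=> xu yE; rewrite exprMn yE mulrDr mulr1 mulrCA mulrV ?mulr1. Qed.

Lemma lift_nonsingular (I : finType) (w : I -> V) (x : I -> Zp) i1 i2 t m r1 r2
    (d := (p ^ t * m)%N) :
  (2 < p)%N -> ~~ (p %| m)%N -> i1 != i2 -> det2 (w i1) (w i2) \is a GRing.unit ->
  x i1 \is a GRing.unit -> x i2 \is a GRing.unit ->
  \sum_i (w i).1 * x i ^+ d = p%:R ^+ t.+1 * r1 ->
  \sum_i (w i).2 * x i ^+ d = p%:R ^+ t.+1 * r2 ->
  exists y : I -> Zp, [/\ y i1 != 0, forall i, x i = 0 -> y i = 0,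
    \sum_i (w i).1 * y i ^+ d = 0 & \sum_i (w i).2 * y i ^+ d = 0].
Proof.
move=> p2 pm i12 Du x1 x2 S1 S2; set D := det2 _ _ in Du.
have e1 : x i1 ^+ d \is a GRing.unit by rewrite unitrX.
have e2 : x i2 ^+ d \is a GRing.unit by rewrite unitrX.
pose d1 := D^-1 * (r2 * (w i2).1 - r1 * (w i2).2).
pose d2 := D^-1 * (r1 * (w i1).2 - r2 * (w i1).1).
have [y1 y1E] := root_exists p2 t (d1 * (x i1 ^+ d)^-1) pm.
have [y2 y2E] := root_exists p2 t (d2 * (x i2 ^+ d)^-1) pm.
rewrite (mulrA _ d1) in y1E; rewrite (mulrA _ d2) in y2E.
have {}y1E := perturb_power e1 y1E; have {}y2E := perturb_power e2 y2E.
pose y i := if i == i1 then x i1 * y1 else if i == i2 then x i2 * y2 else x i.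
have sumE (c : I -> Zp) : \sum_i c i * y i ^+ d =
    \sum_i c i * x i ^+ d + p%:R ^+ t.+1 * (c i1 * d1 + c i2 * d2).
  have i21 : i2 != i1 by rewrite eq_sym.
  rewrite (bigD1 i1) //= (bigD1 i2) //= [in RHS](bigD1 i1) //= [in RHS](bigD1 i2) //=.
  rewrite {1 2}/y eqxx (negPf i21) eqxx y1E y2E.
  rewrite (eq_bigr (fun i => c i * x i ^+ d)) => [|i /andP[/negPf i1' /negPf i2']].
    move: (\sum_(i | _) _) (_ ^+ t.+1) (x i1 ^+ d) (x i2 ^+ d) (c i1) (c i2) => *; ring.
  by rewrite /y i1' i2'.
have Dc : D * D^-1 = 1 by rewrite mulrV.
exists y; split.
- rewrite /y eqxx; apply/eqP => y0; move: y1E; rewrite y0.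
  have d0 : (0 < d)%N.
    rewrite muln_gt0 expn_gt0 prime_gt0 //= lt0n; apply: contraNneq pm => ->.
    exact: dvdn0.
  rewrite expr0n eqn0Ngt d0 /= => /(congr1 (@red p p_pr)); rewrite redD exprS -!mulrA redM.
  rewrite (red_nat p_pr p) (pcharf0 (pchar_Fp p_pr)) mul0r addr0 [LHS]/red residue0.
  by move/esym/eqP; rewrite red_eq0 e1.
- move=> i x0; rewrite /y; case: eqP => [ii|_]; last case: eqP => [ii|//].
    by move: x1; rewrite -ii x0 unitr0.
  by move: x2; rewrite -ii x0 unitr0.
- rewrite (sumE (fun i => (w i).1)) S1 -mulrDr.
  transitivity (p%:R ^+ t.+1 * (r1 * (1 - D * D^-1))); last by rewrite Dc subrr !mulr0.
  by congr (_ * _); rewrite /d1 /d2; move: (D^-1) => Di; rewrite /D /det2; ring.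
- rewrite (sumE (fun i => (w i).2)) S2 -mulrDr.
  transitivity (p%:R ^+ t.+1 * (r2 * (1 - D * D^-1))); last by rewrite Dc subrr !mulr0.
  by congr (_ * _); rewrite /d1 /d2; move: (D^-1) => Di; rewrite /D /det2; ring.
Qed.

Lemma solve_primitive (I : finType) (w : I -> V) (I0 : {set I}) d :
  (2 < p)%N -> (0 < d)%N -> (forall i, i \in I0 -> primitive (w i)) ->
  (d * (2 * p + 4) <= p.-1 * #|I0|)%N ->
  (forall l, d * (2 * p + 4) <= 2 * p.-1 * #|[set i in I0 | lineV (w i) != l]|)%N ->
  exists y : I -> Zp, [/\ exists i, y i != 0, forall i, i \notin I0 -> y i = 0,
    \sum_i (w i).1 * y i ^+ d = 0 & \sum_i (w i).2 * y i ^+ d = 0].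
Proof.
move=> p2 d0 pw cI cL.
have [m pm dE] := pfactor_coprime p_pr d0; set t := logn p d in dE.
rewrite mulnC in dE; rewrite prime_coprime // in pm.
have m0 : (0 < m)%N by case: (m) pm => //; rewrite dvdn0.
have [H [uH Hz Hnz sH]] := power_residues p_pr t m0; rewrite -dE in Hz sH.
have P0 : (0 < p ^ t)%N by rewrite expn_gt0 prime_gt0.
have bound k n : (d * (2 * p + 4) <= k * p.-1 * n)%N ->
    (2 * p ^ t.+1 + 4 * p ^ t <= k * (n * size H))%N.
  move=> kn; have -> : (2 * p ^ t.+1 + 4 * p ^ t = p ^ t * (2 * p + 4))%N by rewrite expnS; ring.
  have p10 : (0 < p.-1)%N by lia.
  rewrite -(leq_pmul2r p10); apply: (@leq_trans (size H * (d * (2 * p + 4)))%N); first by nia.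
  by rewrite [leqRHS](_ : _ = size H * (k * p.-1 * n))%N ?leq_mul2l ?kn ?orbT //; ring.
have {}cI : (2 * p ^ t.+1 + 4 * p ^ t <= #|I0| * size H)%N.
  by have := @bound 1%N #|I0|; rewrite !mul1n; apply.
have {}cL l := bound _ _ (cL l).
have /card_gt0P[i1 i1I] : (0 < #|I0|)%N by move: cI; case: #|I0| => //; rewrite mul0n; lia.
have /card_gt0P[i2] : (0 < #|[set i in I0 | lineV (w i) != lineV (w i1)]|)%N.
  by have := cL (lineV (w i1)); case: #|_| => //; rewrite mul0n; lia.
rewrite inE => /andP[i2I i21]; have i12 : i1 != i2 by apply: contraNneq i21 => ->.
pose a i := if i \in I0 then `|(w i).1 t.+1|%N else 1%N.
pose b i := if i \in I0 then `|(w i).2 t.+1|%N else 0%N.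
(* Withholding the weight 0 at [i1] and [i2] forces units there. *)
pose B i := if i \in I0 then if (i == i1) || (i == i2) then H else 0%N :: H else [:: 0%N].
have H0 : (0 < size H)%N by move: cI; case: (size H) => //; rewrite muln0; lia.
have sB (P : pred I) :
    (#|[set i in I0 | P i]| * size H <= \sum_(i | P i) (size (B i)).-1 + 2)%N.
  have -> : (2 = \sum_i (i == i1) + \sum_i (i == i2))%N.
    by rewrite (bigD1 i1) //= (bigD1 (F := fun i => nat_of_bool (i == i2)) i2) //= !eqxx !big1 // => i /negPf ->.
  rewrite -sum_nat_const -big_split big_mkcond [X in (X + _)%N]big_mkcond -big_split.
  apply: leq_sum => i _; rewrite /= inE /B.
  by case: (i \in I0); case: (P i) => //=; case: (i == i1); case: (i == i2) => /=; lia.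
have [|||||h [hB ha hb]] := @weighted_zero_sum p p_pr t I a b B.
- move=> i; rewrite /a /b; case: ifP => [/pw|_]; last by rewrite oner_eq0.
  by rewrite !red_residue !red_eq0 -negb_or negbK.
- move=> i; rewrite /B; case: ifP => // _; case: ifP => // _ /=.
  by rewrite uH andbT; apply/mapP => -[k /Hnz/eqP k0 /esym].
- by move=> i; rewrite /B; case: ifP => // _; case: ifP.
- rewrite -[leqRHS]/(\sum_i (size (B i)).-1)%N; have := sB xpredT.
  have -> : [set i in I0 | xpredT i] = I0 by apply/setP => i; rewrite inE andbT.
  by move: (\sum_i _)%N cI => S; lia.
- move=> l; rewrite -[leqRHS]/(\sum_(i | line_of (a i)%:R (b i)%:R != l) (size (B i)).-1)%N.
  have := sB (fun i => line_of (a i)%:R (b i)%:R != l).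
  have -> : [set i in I0 | line_of (a i)%:R (b i)%:R != l] = [set i in I0 | lineV (w i) != l].
    by apply/setP => i; rewrite !inE /a /b; case: (i \in I0) => //=; rewrite !red_residue.
  by move: (\sum_(i | _) _)%N (cL l) => S; lia.
have /fin_all_exists[z zP] i : exists z : nat, [/\ h i = (z ^ d)%N,
    i \notin I0 -> z = 0%N & (i == i1) || (i == i2) -> ~~ (p %| z)%N].
  have := hB i; rewrite /B; case: ifP => iI; last first.
    rewrite inE => /eqP ->; exists 0%N; rewrite exp0n //; split=> // /orP[] /eqP ii.
      by move: iI; rewrite ii i1I.
    by move: iI; rewrite ii i2I.
  case: ifP => [_ /Hz[z -> zp]|_]; first by exists z.
  rewrite inE => /orP[/eqP ->|/Hz[z -> zp]]; last by exists z.
  by exists 0%N; rewrite exp0n.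
have sum0 (f : I -> Zp) (g : I -> nat) : (p ^ t.+1 %| \sum_i g i * h i)%N ->
    (forall i, i \in I0 -> f i t.+1 = ((g i)%:R : Zp) t.+1) ->
    exists r, \sum_i f i * (z i)%:R ^+ d = p%:R ^+ t.+1 * r.
  move=> dv fg; apply: residue_sum_dvd dv => i.
  have [-> zi _] := zP i; have [iI|/zi ->] := boolP (i \in I0).
    by rewrite natrM natrX; apply: residueM_congr => //; apply: fg.
  by rewrite exp0n // muln0 expr0n eqn0Ngt d0 mulr0.
have [|r1 S1] := sum0 (fun i => (w i).1) _ ha.
  by move=> i iI; rewrite /a iI natr_absz.
have [|r2 S2] := sum0 (fun i => (w i).2) _ hb.
  by move=> i iI; rewrite /b iI natr_absz.
have [_ _ z1] := zP i1; have [_ _ z2] := zP i2.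
rewrite dE in S1 S2.
have [|||y [y1 y0 Y1 Y2]] := lift_nonsingular p2 pm i12 _ _ _ S1 S2.
- by rewrite det2_unit ?pw // eq_sym.
- by rewrite natr_unit z1 ?eqxx.
- by rewrite natr_unit z2 ?eqxx ?orbT.
exists y; rewrite dE; split => //; first by exists i1.
by move=> i iI; apply: y0; have [_ ->] := zP i.
Qed.

End Solve.

(** * Descent to the given system *)

Section Integral.
Variables (p : nat) (p_pr : prime p) (d : nat).
Hypotheses (p_odd : (2 < p)%N) (d_gt0 : (0 < d)%N).
Local Notation Zp := (padic_int p_pr).
Local Notation V := (Zp * Zp)%type.

Definition solvable_family (I : finType) (v : I -> V) :=
  exists x : I -> Zp, [/\ exists i, x i != 0,
    \sum_i (v i).1 * x i ^+ d = 0 & \sum_i (v i).2 * x i ^+ d = 0].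

Lemma solve_semistable (I : finType) (v : I -> V) :
  (forall i, v i != (0, 0)) ->
  (forall j, 2 * #|[set i | (det2 (v i) (v j) == 0)%R]| <= #|I|)%N ->
  (d * d * (2 * p + 4) <= p.-1 * #|I|)%N -> solvable_family v.
Proof.
move=> v0 semi dI.
have [T [c [w [I0 [T0 wP cI cL]]]]] := normalise d_gt0 v0 semi.
have [y [[i0 yi0] y0 Y1 Y2]] : exists y : I -> Zp,
    [/\ exists i, y i != 0, forall i, i \notin I0 -> y i = 0,
    \sum_i (w i).1 * y i ^+ d = 0 & \sum_i (w i).2 * y i ^+ d = 0].
  apply: (solve_primitive (I0 := I0)) => // [i /wP[]//||l].
    by rewrite -(leq_pmul2l d_gt0); nia.
  by rewrite -(leq_pmul2l d_gt0); have := cL l; nia.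
pose C := (\sum_i c i)%N; have cC i : (c i <= C)%N by rewrite /C (bigD1 i) //= leq_addr.
pose x i := y i * p%:R ^+ (C - c i).
have xE (r : V) (g : V -> Zp) : (forall a u, g (scalev a u) = a * g u) ->
    (forall i, dot r (v i) = g (act T (v i))) ->
    \sum_i g (w i) * y i ^+ d = 0 -> \sum_i dot r (v i) * x i ^+ d = 0.
  move=> gZ gE S0.
  transitivity (p%:R ^+ (d * C) * \sum_i g (w i) * y i ^+ d); last by rewrite S0 mulr0.
  rewrite mulr_sumr.
  apply: eq_bigr => i _; rewrite gE /x exprMn; have [iI|/y0 ->] := boolP (i \in I0); last first.
    by rewrite !expr0n eqn0Ngt d_gt0 !(mulr0, mul0r).
  have [_ ->] := wP i iI; rewrite gZ -exprM.
  rewrite (_ : d * C = d * c i + (C - c i) * d)%N ?exprD; last by have := cC i; nia.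
  by ring.
have X1 := xE T.1 fst (fun _ _ => erefl) (fun _ => erefl) Y1.
have X2 := xE T.2 snd (fun _ _ => erefl) (fun _ => erefl) Y2.
exists x.
have lin r : dot r (\sum_i (v i).1 * x i ^+ d, \sum_i (v i).2 * x i ^+ d)
    = \sum_i dot r (v i) * x i ^+ d.
  rewrite /dot /= !mulr_sumr -big_split; apply: eq_bigr => i _ /=.
  by rewrite mulrDl !mulrA.
have E : act T (\sum_i (v i).1 * x i ^+ d, \sum_i (v i).2 * x i ^+ d) = (0, 0).
  by rewrite /act !lin X1 X2.
have E0 := act_eq0 T0 E; split; [exists i0|by have /= := congr1 fst E0|by have /= := congr1 snd E0].
by rewrite /x mulf_neq0 // pX_neq0.
Qed.

Lemma solve_one_form (I : finType) (a : I -> Zp) : (forall i, a i != 0) ->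
  (d * d * (2 * p + 4) <= p.-1 * (2 * #|I|))%N ->
  exists2 x : I -> Zp, exists i, x i != 0 & \sum_i a i * x i ^+ d = 0.
Proof.
move=> a0 dI.
pose v (ib : I * bool) : V := if ib.2 then (a ib.1, 0) else (0, a ib.1).
have [|j||x [[[i b] xi0] X1 X2]] := @solve_semistable _ v.
- by case=> i []; rewrite /v xpair_eqE /= eqxx ?andbT ?(negPf (a0 i)).
- rewrite card_prod card_bool mulnC leq_mul2r /=.
  apply: (@leq_trans #|[set (i, j.2) | i : I]|); last first.
    by rewrite (leq_trans (leq_imset_card _ _)) // cardE.
  apply/subset_leq_card/subsetP => -[i b]; rewrite inE => h; apply/imsetP; exists i => //.
  congr (_, _); case: j b h => j [] [] //; rewrite /v /det2 /=.
    by rewrite !mul0r sub0r oppr_eq0 mulf_eq0 !(negPf (a0 _)).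
  by rewrite mul0r subr0 mulf_eq0 !(negPf (a0 _)).
- by rewrite card_prod card_bool [(_ * 2)%N]mulnC.
have sum2 (f : I * bool -> Zp) : \sum_ib f ib = \sum_i (f (i, true) + f (i, false)).
  rewrite (eq_bigr (fun ib => f (ib.1, ib.2))) => [|[]//].
  rewrite -(pair_bigA _ (fun i b => f (i, b))) /=; apply: eq_bigr => k _.
  by rewrite big_bool.
case: b xi0 => xi0; [exists (fun i => x (i, true))|exists (fun i => x (i, false))]; try by exists i.
  by rewrite -[RHS]X1 sum2; apply: eq_bigr => k _; rewrite /v /= mul0r addr0.
by rewrite -[RHS]X2 sum2; apply: eq_bigr => k _; rewrite /v /= mul0r add0r.
Qed.

Lemma solve_line (I : finType) (a b : I -> Zp) j (L := [set i | a i * b j == b i * a j]) :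
  a j != 0 -> (forall i, i \in L -> a i != 0) ->
  (d * d * (2 * p + 4) <= p.-1 * (2 * #|L|))%N -> solvable_family (fun i => (a i, b i)).
Proof.
move=> aj0 a0 dL.
have [||x [[i iL] xi0] X] := @solve_one_form {i | i \in L} (fun i => a (sval i)).
- by case=> i iL; apply: a0.
- by rewrite card_sig.
pose y i := if insub i is Some k then x k else 0 : Zp.
have sumE (f : I -> Zp) : \sum_i f i * y i ^+ d = \sum_(k : {i | i \in L}) f (sval k) * x k ^+ d.
  rewrite (bigID (mem L)) /= [X in _ + X]big1 ?addr0 => [|i' iL']; last first.
    by rewrite /y insubN // expr0n eqn0Ngt d_gt0 mulr0.
  rewrite (reindex_omap (fun k : {i | i \in L} => sval k) insub) => [|i' iL' /=].
    apply: eq_big => [[k kL]|[k kL] _] /=; first by rewrite kL insubT eqxx.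
    by rewrite /y insubT.
  by rewrite insubT.
exists y; split.
- by exists i; rewrite /y insubT.
- by rewrite sumE.
rewrite sumE; apply: (mulfI aj0); rewrite mulr0.
transitivity (b j * \sum_(k : {i | i \in L}) a (sval k) * x k ^+ d); last by rewrite X mulr0.
rewrite !mulr_sumr.
apply: eq_bigr => -[k kL] _ /=; have := kL; rewrite inE => /eqP E.
by rewrite !mulrA [a j * _]mulrC -E [b j * _]mulrC.
Qed.

Lemma solve_integral (I : finType) (v : I -> V) :
  (d * d * (2 * p + 4) <= p.-1 * #|I|)%N -> solvable_family v.
Proof.
move=> dI; have [[i vi0]|v0] := pselect (exists i, v i = (0, 0)).
  have dn0 : (d == 0)%N = false by rewrite eqn0Ngt d_gt0.
  exists (fun j => (j == i)%:R); split; first by exists i; rewrite eqxx oner_eq0.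
    by rewrite big1 // => j _; case: eqP => [->|_]; rewrite ?vi0 ?mul0r // expr0n dn0 mulr0.
  by rewrite big1 // => j _; case: eqP => [->|_]; rewrite ?vi0 ?mul0r // expr0n dn0 mulr0.
have {}v0 i : v i != (0, 0) by apply/eqP => vi; apply: v0; exists i.
have [semi|] := pselect (forall j, 2 * #|[set i | (det2 (v i) (v j) == 0)%R]| <= #|I|)%N.
  exact: solve_semistable.
move=> /existsNP[j /negP]; rewrite -ltnNge => jI.
set L := [set i | _] in jI.
have dL : (d * d * (2 * p + 4) <= p.-1 * (2 * #|L|))%N.
  by apply: leq_trans dI _; rewrite leq_mul2l ltnW ?orbT.
have LE : L = [set i | (v i).1 * (v j).2 == (v i).2 * (v j).1].
  by apply/setP => i; rewrite !inE /det2 subr_eq0.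
have LE' : L = [set i | (v i).2 * (v j).1 == (v i).1 * (v j).2].
  by apply/setP => i; rewrite LE !inE eq_sym.
have [v1|v1] := eqVneq (v j).1 0; last first.
  have [||x [x0 X1 X2]] := @solve_line I (fun i => (v i).1) (fun i => (v i).2) j v1.
  - move=> i; rewrite inE => /eqP E; apply: contra_neq (v0 i) => vi1.
    move/eqP: E; rewrite vi1 mul0r eq_sym mulf_eq0 (negPf v1) orbF => /eqP vi2.
    by case: (v i) vi1 vi2 => ? ? /= -> ->.
  - by rewrite -LE.
  by exists x.
have v2 : (v j).2 != 0.
  by apply: contra_neq (v0 j) => v2; case: (v j) v1 v2 => ? ? /= -> ->.
have [||x [x0 X1 X2]] := @solve_line I (fun i => (v i).2) (fun i => (v i).1) j v2.
- move=> i; rewrite inE => /eqP E; apply: contra_neq (v0 i) => vi2.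
  move/eqP: E; rewrite vi2 mul0r eq_sym mulf_eq0 (negPf v2) orbF => /eqP vi1.
  by case: (v i) vi1 vi2 => ? ? /= -> ->.
- by rewrite -LE'.
by exists x.
Qed.
End Integral.

Lemma common_denominator (R : idomainType) (I : finType) (a : I -> {fraction R}) :
  exists2 D : R, D != 0 & exists A : I -> R, forall i, FracField.tofrac D * a i = FracField.tofrac (A i).
Proof.
have /fin_all_exists2[n n0 nE] i : exists2 e : R * R, e.2 != 0 &
    FracField.tofrac e.2 * a i = FracField.tofrac e.1.
  elim/quotW: (a i) => r; exists (\n_r, \d_r) => /=; first exact: denom_ratioP.
  unlock FracField.tofrac; rewrite -[LHS]FracField.pi_mul; apply/eqmodP.
  rewrite /= FracField.equivfE /FracField.mulf /=.
  have dr := denom_ratioP r.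
  by rewrite !numden_Ratio ?mulf_neq0 ?oner_neq0 // !mul1r !mulr1.
exists (\prod_i (n i).2); first by apply/prodf_neq0 => i _.
exists (fun i => (n i).1 * \prod_(k | k != i) (n k).2) => i.
by rewrite (bigD1 i) //= !tofracM mulrAC nE.
Qed.

Theorem theorem1p2 (R : realType) (eps : R) (heps : 0 < eps) :
  exists P : nat,
    forall (p : nat) (p_pr : prime p), (P <= p)%N ->
    forall (d s : nat), (0 < d)%N -> (2 + eps) * d%:R ^+ 2 < s%:R ->
    forall a b : 'I_s -> padic p_pr,
    exists x : 'rV[padic p_pr]_s,
      [/\ x != 0,
          \sum_(i < s) a i * x 0 i ^+ d = 0 &
          \sum_(i < s) b i * x 0 i ^+ d = 0].
Proof.
pose P := (maxn 3 (Num.truncn (6 / eps)).+2)%N.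
exists P => p p_pr; rewrite geq_max => /andP[p3 pP] d s d0 sd a b.
have ep : 6 <= eps * p.-1%:R.
  rewrite -ler_pdivrMl // mulrC (le_trans (ltW (truncnS_gt _))) // ler_nat.
  by rewrite -ltnS prednK // (ltn_trans _ p3).
have ds : (d * d * (2 * p + 4) <= p.-1 * s)%N.
  have pE : p%:R = p.-1%:R + 1 :> R by rewrite natr1 prednK // (ltn_trans _ p3).
  rewrite -(ler_nat R) !natrM natrD natrM pE; apply: le_trans (ler_wpM2l _ (ltW sd)); last first.
    exact: ler0n.
  rewrite expr2; have dd : 0 <= d%:R * d%:R :> R by rewrite mulr_ge0 // ler0n.
  have : 0 <= (eps * p.-1%:R - 6) * (d%:R * d%:R) by rewrite mulr_ge0 // subr_ge0.
  by move: (p.-1%:R) => q; nra.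
have [Da Da0 [A AE]] := common_denominator a.
have [Db Db0 [B BE]] := common_denominator b.
have [|x [[i xi0] X1 X2]] := @solve_integral p p_pr d p3 d0 _ (fun i : 'I_s => (A i, B i)).
  by rewrite card_ord.
have clear_den (c : 'I_s -> padic p_pr) D C : D != 0 ->
    (forall i, FracField.tofrac D * c i = FracField.tofrac (C i)) ->
    \sum_i C i * x i ^+ d = 0 ->
    \sum_i c i * (\row_j FracField.tofrac (x j)) 0 i ^+ d = 0.
  move=> D0 cE S0; apply: (mulfI (x := FracField.tofrac D)); first by rewrite tofrac_eq0.
  transitivity (FracField.tofrac (\sum_i C i * x i ^+ d)); last by rewrite S0 tofrac0 mulr0.
  rewrite mulr_sumr rmorph_sum; apply: eq_bigr => k _.
  by rewrite mxE mulrA cE rmorphM rmorphXn.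
exists (\row_j FracField.tofrac (x j)); split.
- by apply: contra_neq xi0 => /rowP/(_ i)/eqP; rewrite !mxE tofrac_eq0 => /eqP.
- exact: clear_den Da0 AE X1.
- exact: clear_den Db0 BE X2.
Qed.
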